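(* Let $v\in\tilde W^a$ and let $t$ be the type of a minimal gallery connecting $A_f$ and $A_v$. Then for every $A\in\tilde{\mathcal A}$, \[ X_AT_v=\sum_{B\in\tilde{\mathcal A}}L_t(A,B)\,X_B. \]
   Context: $\Phi=(X,\phi,X^\vee,\phi^\vee)$ is a reduced root datum with finite Weyl group $W$, positive roots $\phi^+$, $V^*=X^\vee\otimes\mathbb R$. Alcoves: closures of components of $V^*\setminus\bigcup_{\alpha\in\phi^+,m\in\mathbb Z}\{\langle\alpha,x\rangle=m\}$; $A_f=\{0\le\langle\alpha,x\rangle\le1\}$. $\tilde W^a=W\ltimes X^\vee$ ($\tau_\mu$ translations), $W^a=W\ltimes Q^\vee$ Coxeter group with generators $S^a$ = reflections in walls of $A_f$, $\Omega$ the stabilizer of $A_f$, $\tilde W^a=\Omega\ltimes W^a$, $l(wg)=l(w)$. Generalized alcoves $\tilde{\mathcal A}=\{(A,\mu):\mu\in A\cap X^\vee\}$, free transitive componentwise $\tilde W^a$-action, $A_v=v\cdot(A_f,0)$, right action $A_vu=A_{vu}$; each $A$ is uniquely $\mu+A_w$ ($w\in W$), $wt(A)=\mu$, $\delta(A)=w$. For $s\in S^a$: $A\prec As$ if the alcove of $A$ lies on the side $\langle\alpha,x\rangle\le m$ of the hyperplane $H_{\alpha,m}$ containing the common face of $A$ and $As$, otherwise $A\succ As$. Galleries: a type is $t=(t_1,\dots,t_k)$, $t_i\in S^a\cup\Omega$; a gallery of type $t$ connecting $A$ and $B$ is $(A=A_0,\dots,A_k=B)$ with $A_{i+1}=A_it_{i+1}$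 if $t_{i+1}\in\Omega$, $A_{i+1}\in\{A_i,A_it_{i+1}\}$ otherwise; minimal = of minimal length among galleries connecting the same generalized alcoves. Positive $s$-direction at $i$: $t_{i+1}=s$, $A_{i+1}=A_is$, $A_i\prec A_is$; $s$-fold at $i$: $A_{i+1}=A_i$, positive if $A_i\succ A_is$; positively folded = all folds positive. Parameters: $d:S^a\to\mathbb N$ invariant under $\tilde W^a$-conjugation, $\mathcal L=\mathbb Z[q^{\pm1/2}]$, $q_s=q^{d(s)}$, $q_v=\prod q_{t_j}$ for reduced $v=t_1\cdots t_kg$; $q_\lambda=q_{\tau_\lambda}^{1/2}$ for dominant $\lambda$, $q_{\lambda-\lambda'}=q_\lambda/q_{\lambda'}$. $L_\sigma=\prod_s q_s^{m_s(\sigma)}(q_s-1)^{n_s(\sigma)}$ ($m_s$ = number of positive $s$-directions, $n_s$ = number of $s$-folds); $L_t(A,B)=\sum L_\sigma$ over positively folded galleries $\sigma$ of type $t$ connecting $A$ and $B$. Hecke algebra $\tilde{\mathcal H}$: $\mathcal L$-basis $T_w$ ($w\in\tilde W^a$), $T_s^2=q_sT_{id}+(q_s-1)T_s$, $T_vT_w=T_{vw}$ if lengths add; $\overline T_w=T_{w^{-1}}^{-1}$; $X_{\lambda-\lambda'}=q_{\lambda-\lambda'}^{-1}T_{\tau_\lambda}T_{\tau_{\lambda'}}^{-1}$; $X_A=q_{-wt(A)}q_{\delta(A)}X_{wt(A)}\overline T_{\delta(A)}$. *)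

(* Defs.v *)
From HB Require Import structures.
From mathcomp Require Import all_boot all_order all_algebra.
From mathcomp Require Import all_classical all_reals topology normedtype.
Set Implicit Arguments.
Unset Strict Implicit.
Unset Printing Implicit Defensive.
Import Order.TTheory GRing.Theory Num.Theory.
Import numFieldNormedType.Exports.
Local Open Scope classical_set_scope.
Local Open Scope ring_scope.

(* Writing 'X for q^(1/2), this is the subring of Frac Z['X] consisting of the
   fractions whose denominator is a power of 'X. *)
Definition laurent_pred (x : {fraction {poly int}}) : bool :=
  `[< exists p n, x = tofrac p / tofrac 'X ^+ n >].

Lemma tofracX_neq0 : tofrac ('X : {poly int}) != 0.
Proof. by rewrite tofrac_eq0 polyX_eq0. Qed.

Lemma tofracXn_neq0 n : tofrac ('X : {poly int}) ^+ n != 0.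
Proof. by rewrite expf_neq0 // tofracX_neq0. Qed.

Lemma laurent_subring : subring_closed laurent_pred.
Proof.
split.
- by apply/asboolP; exists 1, 0%N; rewrite rmorph1 expr0 divr1.
- move=> x y /asboolP[p [m ->]] /asboolP[r [n ->]]; apply/asboolP.
  exists (p * 'X ^+ n - r * 'X ^+ m), (m + n)%N.
  by rewrite rmorphB !rmorphM !rmorphXn /= exprD -[in LHS]mulNr addf_div
    ?tofracXn_neq0 // mulNr.
- move=> x y /asboolP[p [m ->]] /asboolP[r [n ->]]; apply/asboolP.
  exists (p * r), (m + n)%N.
  by rewrite rmorphM /= exprD mulf_div.
Qed.

HB.instance Definition _ := GRing.isSubringClosed.Build
  {fraction {poly int}} laurent_pred laurent_subring.

Record laurent := Laurent {
  laurent_val :> {fraction {poly int}};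
  _ : laurent_val \in laurent_pred }.

HB.instance Definition _ := [isSub for laurent_val].
HB.instance Definition _ := [Choice of laurent by <:].
HB.instance Definition _ := [SubChoice_isSubComNzRing of laurent by <:].

Definition laurent_unit (x : laurent) : bool := `[< exists y, y * x = 1 >].
Definition laurent_inv (x : laurent) : laurent := xget x [set y | y * x = 1].

Lemma laurent_mulVr : {in laurent_unit, left_inverse 1 laurent_inv *%R}.
Proof. by move=> x /asboolP ex; exact: (xgetPex x ex). Qed.

Lemma laurent_unitP (x y : laurent) : y * x = 1 -> laurent_unit x.
Proof. by move=> yx; apply/asboolP; exists y. Qed.

Lemma laurent_inv_out : {in [predC laurent_unit], laurent_inv =1 id}.
Proof.
move=> x; rewrite inE => /asboolPn nx.
by rewrite /laurent_inv; case: xgetP => // y _ yx; case: nx; exists y.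
Qed.

HB.instance Definition _ := GRing.ComNzRing_hasMulInverse.Build laurent
  laurent_mulVr laurent_unitP laurent_inv_out.

Lemma qhalf_subproof : tofrac 'X \in laurent_pred.
Proof. by apply/asboolP; exists 'X, 0%N; rewrite expr0 divr1. Qed.

(* q^(1/2) *)
Definition qhalf : laurent := Laurent qhalf_subproof.

(* The dual lattices X and X^v are Z^n, written as row and column vectors, with
   <x, y> = x *m y (any perfect pairing takes this form in dual bases). *)
Definition pairing n (x : 'rV[int]_n) (y : 'cV[int]_n) : int := (x *m y) 0 0.

(* Acts on X^v by y |-> refl_mx *m y = y - <a, y> av
   and on X by x |-> x *m refl_mx = x - <x, av> a. *)
Definition refl_mx n (a : 'rV[int]_n) (av : 'cV[int]_n) : 'M[int]_n :=
  1%:M - av *m a.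

(* The finite set phi is the support of the sequence [roots]; [coroot] is only
   meaningful on phi. *)
Record root_datum := RootDatum {
  rk : nat;
  roots : seq 'rV[int]_rk;
  coroot : 'rV[int]_rk -> 'cV[int]_rk;
  coroot_inj : {in roots &, injective coroot};
  root_coroot : forall a, a \in roots -> pairing a (coroot a) = 2;
  root_refl : forall a b, a \in roots -> b \in roots ->
    b *m refl_mx a (coroot a) \in roots;
  coroot_refl : forall a b, a \in roots -> b \in roots ->
    refl_mx a (coroot a) *m coroot b \in map coroot roots;
  root_reduced : forall a b (m k : int), a \in roots -> b \in roots ->
    m != 0 -> m *: a = k *: b -> b = a \/ b = - a }.

Section WeylGroups.
Variable Phi : root_datum.
Local Notation n := (rk Phi).

Definition srefl (a : 'rV[int]_n) : 'M[int]_n := refl_mx a (coroot a).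

Definition weyl_pred (M : 'M[int]_n) : bool :=
  `[< exists2 s : seq 'rV[int]_n, {subset s <= roots Phi} &
        M = \prod_(a <- s) srefl a >].

Record weyl := Weyl { weyl_val :> 'M[int]_n; weylP : weyl_val \in weyl_pred }.

HB.instance Definition _ := [isSub for weyl_val].
HB.instance Definition _ := [Choice of weyl by <:].

Lemma srefl_sq a : a \in roots Phi -> srefl a *m srefl a = 1%:M.
Proof.
move=> ra; rewrite /srefl /refl_mx; set M := _ *m a.
have MM : M *m M = M *+ 2.
  rewrite /M mulmxA -(mulmxA (coroot a)) [a *m _]mx11_scalar.
  have := root_coroot ra; rewrite /pairing => ->.
  by rewrite mul_mx_scalar -scalemxAl scaler_nat.
by rewrite mulmxBl mul1mx mulmxBr mulmx1 MM mulr2n opprB addrK subrK.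
Qed.

Lemma weyl1_subproof : 1%:M \in weyl_pred.
Proof. by apply/asboolP; exists [::] => //; rewrite big_nil. Qed.

Lemma weylM_subproof (u v : weyl) : u *m v \in weyl_pred.
Proof.
have /asboolP[s ss ->] := weylP u; have /asboolP[r rs ->] := weylP v.
apply/asboolP; exists (s ++ r); last by rewrite big_cat.
by move=> a; rewrite mem_cat => /orP[/ss|/rs].
Qed.

Lemma weyl_inv_ex (u : weyl) :
  exists2 M, M \in weyl_pred & M *m u = 1%:M /\ u *m M = 1%:M.
Proof.
have /asboolP[s ss ->] := weylP u.
exists (\prod_(a <- rev s) srefl a).
  by apply/asboolP; exists (rev s) => // a; rewrite mem_rev => /ss.
elim: s ss => [|a s IH] ss; first by rewrite !big_nil !mulmx1.
have ra : a \in roots Phi by apply: ss; rewrite mem_head.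
have /IH[h1 h2] : {subset s <= roots Phi}.
  by move=> b bs; apply: ss; rewrite in_cons bs orbT.
rewrite rev_cons -cats1 big_cat /= big_seq1 !big_cons.
split; first by rewrite -[_ * srefl a]/(_ *m _) -[srefl a * _]/(_ *m _)
  -mulmxA (mulmxA (srefl a)) srefl_sq // mul1mx.
by rewrite -[_ * srefl a]/(_ *m _) -[srefl a * _]/(_ *m _)
  -mulmxA (mulmxA _ _ (srefl a)) h2 mul1mx srefl_sq.
Qed.

Lemma weylV_subproof (u : weyl) : invmx u \in weyl_pred.
Proof.
have [M wM [Mu uM]] := weyl_inv_ex u; suff -> : invmx u = M by [].
have /mulmx1_unit[_ uu] := Mu.
by rewrite -[LHS]mul1mx -Mu -mulmxA mulmxV // mulmx1.
Qed.

Definition weyl_one : weyl := Weyl weyl1_subproof.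
Definition weyl_mul u v : weyl := Weyl (weylM_subproof u v).
Definition weyl_inv u : weyl := Weyl (weylV_subproof u).

Lemma weyl_mulA : associative weyl_mul.
Proof. by move=> u v w; apply: val_inj; rewrite /= mulmxA. Qed.
Lemma weyl_mul1w : left_id weyl_one weyl_mul.
Proof. by move=> u; apply: val_inj; rewrite /= mul1mx. Qed.
Lemma weyl_mulw1 : right_id weyl_one weyl_mul.
Proof. by move=> u; apply: val_inj; rewrite /= mulmx1. Qed.

Lemma weyl_unit (u : weyl) : val u \in unitmx.
Proof. by have [M _ [/mulmx1_unit[]]] := weyl_inv_ex u. Qed.

Lemma weyl_mulVw : left_inverse weyl_one weyl_inv weyl_mul.
Proof. by move=> u; apply: val_inj; rewrite /= mulVmx // weyl_unit. Qed.
Lemma weyl_mulwV : right_inverse weyl_one weyl_inv weyl_mul.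
Proof. by move=> u; apply: val_inj; rewrite /= mulmxV // weyl_unit. Qed.

HB.instance Definition _ := isGroup.Build weyl
  weyl_mulA weyl_mul1w weyl_mulw1 weyl_mulVw weyl_mulwV.

(* The element tau_(trans v) (lin v) of the semidirect product of W and X^v. *)
Record extW := ExtW { lin : weyl; trans : 'cV[int]_n }.

Definition extW_to_pair (v : extW) := (lin v, trans v).
Definition pair_to_extW (p : weyl * 'cV[int]_n) := ExtW p.1 p.2.
Lemma extW_pairK : cancel extW_to_pair pair_to_extW.
Proof. by case. Qed.
HB.instance Definition _ := Choice.copy extW (can_type extW_pairK).

Definition extW_one := ExtW weyl_one 0.
Definition extW_mul (u v : extW) : extW :=
  ExtW (weyl_mul (lin u) (lin v)) (trans u + lin u *m trans v).
Definition extW_inv (u : extW) : extW :=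
  ExtW (weyl_inv (lin u)) (- (weyl_inv (lin u) *m trans u)).

Lemma extW_mulA : associative extW_mul.
Proof.
move=> [u a] [v b] [w c]; rewrite /extW_mul /= weyl_mulA.
by rewrite mulmxDr mulmxA addrA.
Qed.
Lemma extW_mul1w : left_id extW_one extW_mul.
Proof. by move=> [u a]; rewrite /extW_mul /= weyl_mul1w add0r mul1mx. Qed.
Lemma extW_mulw1 : right_id extW_one extW_mul.
Proof. by move=> [u a]; rewrite /extW_mul /= weyl_mulw1 mulmx0 addr0. Qed.
Lemma extW_mulVw : left_inverse extW_one extW_inv extW_mul.
Proof. by move=> [u a]; rewrite /extW_mul /= weyl_mulVw addNr. Qed.
Lemma extW_mulwV : right_inverse extW_one extW_inv extW_mul.
Proof.
move=> [u a]; rewrite /extW_mul /= weyl_mulwV mulmxN mulmxA.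
by rewrite mulmxV ?weyl_unit // mul1mx subrr.
Qed.

HB.instance Definition _ := isGroup.Build extW
  extW_mulA extW_mul1w extW_mulw1 extW_mulVw extW_mulwV.

Definition tau (mu : 'cV[int]_n) : extW := ExtW 1%g mu.

End WeylGroups.

(* A root datum together with a system of positive roots: those roots taking
   positive values at some gamma in V^* that lies on no root hyperplane. *)
Record based_root_datum (R : realType) := BasedRootDatum {
  datum :> root_datum;
  pos : seq 'rV[int]_(rk datum);
  posP : exists gamma : 'cV[R]_(rk datum),
    (forall a, a \in roots datum -> (map_mx intr a *m gamma) 0 0 != 0) /\
    (forall a, (a \in pos) =
               (a \in roots datum) && (0 < (map_mx intr a *m gamma) 0 0)) }.

Section Alcoves.
Variables (R : realType) (P : based_root_datum R).
Local Notation n := (rk P).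
Local Notation X := 'rV[int]_n.
Local Notation Xv := 'cV[int]_n.
Local Notation V := 'cV[R]_n.

Definition inV (mu : Xv) : V := map_mx intr mu.
Definition evalV (a : X) (x : V) : R := (map_mx intr a *m x) 0 0.

Definition hyp (a : X) (m : int) : set V := [set x | evalV a x = m%:~R].

Definition alcove (A : set V) : Prop :=
  let U := ~` [set x | exists a m, a \in pos P /\ hyp a m x] in
  exists2 x, U x & A = closure (connected_component U x).

Definition Af : set V :=
  [set x | forall a, a \in pos P -> 0 <= evalV a x <= 1].

Definition act (v : extW P) (x : V) : V :=
  map_mx intr (lin v : 'M[int]_n) *m x + inV (trans v).

(* H_(a,m) is a wall of A_f when A_f `&` H_(a,m) is a facet, that is, has
   nonempty interior relative to H_(a,m). *)
Definition wall (a : X) (m : int) : Prop :=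
  exists2 x, hyp a m x & \forall y \near x, hyp a m y -> Af y.

(* The affine reflection x |-> x - (<a, x> - m) a^v in H_(a,m) is s. *)
Definition is_arefl (a : X) (m : int) (s : extW P) : Prop :=
  (lin s : 'M[int]_n) = srefl a /\ trans s = m *: coroot a.

Definition simple (s : extW P) : bool :=
  `[< exists a m, [/\ a \in pos P, wall a m & is_arefl a m s] >].
Definition stabAf (g : extW P) : bool := `[< act g @` Af = Af >].

Definition Sa := {s : extW P | simple s}.
Definition Omega := {g : extW P | stabAf g}.

(* [word_of v s] : v = s_1 ... s_k g for some g in Omega. *)
Definition word_of (v : extW P) (s : seq Sa) : Prop :=
  exists g : Omega, v = (\prod_(x <- s) val x * val g)%g.
Definition reduced_word (v : extW P) (s : seq Sa) : Prop :=
  word_of v s /\ forall s', word_of v s' -> (size s <= size s')%N.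

Definition redw (v : extW P) : seq Sa := xget [::] [set s | reduced_word v s].
Definition len (v : extW P) : nat := size (redw v).

Definition galc := (set V * Xv)%type.
Definition galcoves : set galc := [set A | alcove A.1 /\ A.1 (inV A.2)].

(* A_v = v (A_f, 0) *)
Definition alc (v : extW P) : galc := (act v @` Af, trans v).

(* Inverse of v |-> A_v. Since A_(tau_mu w) = mu + A_w, the two components
   of [elt A] are wt(A) and delta(A). *)
Definition elt (A : galc) : extW P := xget 1%g [set v | alc v = A].
Definition wt (A : galc) : Xv := trans (elt A).
Definition delta (A : galc) : extW P := ExtW (lin (elt A)) 0.
Definition ract (A : galc) (u : extW P) : galc := alc (elt A * u)%g.

(* A < A s; its negation is A > A s. *)
Definition prec (A : galc) (s : Sa) : Prop :=
  exists a m, [/\ a \in pos P, A.1 `&` (ract A (val s)).1 `<=` hyp a m &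
                  A.1 `<=` [set x | evalV a x <= m%:~R]].

Definition gtype := seq (Sa + Omega).

(* The sequence g is (A_0, ..., A_k), and t_(i+1) is the i-th item of t. *)
Definition gnth (g : seq galc) (i : nat) : galc := nth (alc 1%g) g i.

Definition gstep (t : gtype) (g : seq galc) (i : nat) : Prop :=
  match onth t i with
  | Some (inl s) => gnth g i.+1 = gnth g i \/
                    gnth g i.+1 = ract (gnth g i) (val s)
  | Some (inr w) => gnth g i.+1 = ract (gnth g i) (val w)
  | None => False
  end.

Definition gallery (t : gtype) (A B : galc) (g : seq galc) : Prop :=
  [/\ size g = (size t).+1, forall C, C \in g -> galcoves C,
      gnth g 0 = A, gnth g (size t) = B &
      forall i, (i < size t)%N -> gstep t g i].

Definition minimal_gallery (t : gtype) (A B : galc) (g : seq galc) : Prop :=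
  gallery t A B g /\
  forall t' g', gallery t' A B g' -> (size g <= size g')%N.

Definition pos_direction (t : gtype) (g : seq galc) (s : Sa) (i : nat) : Prop :=
  [/\ onth t i = Some (inl s), gnth g i.+1 = ract (gnth g i) (val s) &
      prec (gnth g i) s].

Definition fold (t : gtype) (g : seq galc) (s : Sa) (i : nat) : Prop :=
  onth t i = Some (inl s) /\ gnth g i.+1 = gnth g i.

Definition pos_folded (t : gtype) (g : seq galc) : Prop :=
  forall s i, fold t g s i -> ~ prec (gnth g i) s.

Definition num_pos_dir (t : gtype) (g : seq galc) (s : Sa) : nat :=
  count (fun i => `[< pos_direction t g s i >]) (iota 0 (size t)).
Definition num_fold (t : gtype) (g : seq galc) (s : Sa) : nat :=
  count (fun i => `[< fold t g s i >]) (iota 0 (size t)).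

Definition conj_invariant (d : Sa -> nat) : Prop :=
  forall (s s' : Sa) (v : extW P), val s' = (v * val s * v^-1)%g -> d s = d s'.

Definition dominant (mu : Xv) : Prop :=
  forall a, a \in pos P -> 0 <= pairing a mu.

Section Weights.
Variable d : Sa -> nat.

Definition qs (s : Sa) : laurent := (qhalf ^+ 2) ^+ d s.
Definition qw (v : extW P) : laurent := \prod_(s <- redw v) qs s.

(* q_v^(1/2) *)
Definition qw_half (v : extW P) : laurent := \prod_(s <- redw v) qhalf ^+ d s.

(* q_mu = q_l / q_l' for any dominant l and l' with mu = l - l' *)
Definition qX (mu : Xv) : laurent :=
  xget 0 [set c | exists l l', [/\ dominant l, dominant l', mu = l - l' &
                                   c = qw_half (tau l) / qw_half (tau l')]].

Definition Lg (t : gtype) (g : seq galc) : laurent :=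
  \big[*%R/1]_(s \in [set: Sa])
    (qs s ^+ num_pos_dir t g s * (qs s - 1) ^+ num_fold t g s).

Definition Lt (t : gtype) (A B : galc) : laurent :=
  \sum_(g \in [set g | gallery t A B g /\ pos_folded t g]) Lg t g.

(* The presentation that characterizes the algebra with its basis up to unique
   isomorphism. *)
Record hecke_algebra (H : unitAlgType laurent) (T : extW P -> H) : Prop :=
  HeckeAlgebra {
  hecke_free : forall (r : seq (extW P)) (c : extW P -> laurent), uniq r ->
    \sum_(w <- r) c w *: T w = 0 -> forall w, w \in r -> c w = 0;
  hecke_span : forall h : H, exists (r : seq (extW P)) (c : extW P -> laurent),
    h = \sum_(w <- r) c w *: T w;
  hecke_quad : forall s : Sa,
    T (val s) ^+ 2 = qs s *: T 1%g + (qs s - 1) *: T (val s);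
  hecke_mul : forall v w : extW P, len (v * w)%g = (len v + len w)%N ->
    T v * T w = T (v * w)%g }.

Variables (H : unitAlgType laurent) (T : extW P -> H).

Definition Tbar (w : extW P) : H := (T (w^-1)%g)^-1.

(* X_mu = q_mu^-1 T_(tau_l) T_(tau_l')^-1 for any dominant l and l' with
   mu = l - l' *)
Definition XX (mu : Xv) : H :=
  xget 0 [set x | exists l l', [/\ dominant l, dominant l', mu = l - l' &
                  x = (qX mu)^-1 *: (T (tau l) * (T (tau l'))^-1)]].

Definition XA (A : galc) : H :=
  (qX (- wt A) * qw (delta A)) *: (XX (wt A) * Tbar (delta A)).

End Weights.
End Alcoves.

Arguments galcoves {R} P _.

(* Main.v *)
(* When u A_f lies deep enough in the dominant chamber, X_(A_u) = q_u^-1 T_u.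
   Translating by a dominant tau_l multiplies X_A on the left by a scalar times
   T_(tau_l), so every X_A is a left translate of such an element.  Deep in the
   dominant chamber, A < A s means that the length increases, hence
   X_A T_s = q_s X_(A s) if A < A s; applying this to A s and using the
   quadratic relation, X_A T_s = X_(A s) + (q_s - 1) X_A if A > A s.  For g in
   Omega, X_A T_g = X_(A g).  Since a minimal gallery is a reduced expression of
   v, T_v is the product of the elements T_(t_i), and expanding the product one
   factor at a time produces the positively folded galleries.

   Lengths are counted by affine roots: the length of v is the number of
   positive affine roots that v makes negative, and the only positive affine
   root made negative by a simple reflection is the one defining its wall. *)
Require Import Defs.
From mathcomp Require Import all_boot all_order all_algebra.
From mathcomp Require Import all_classical all_reals topology normedtype.
From mathcomp Require Import ring lra zify.
Set Implicit Arguments.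
Unset Strict Implicit.
Unset Printing Implicit Defensive.
Import Order.TTheory GRing.Theory Num.Theory.
Import numFieldNormedType.Exports.
Local Open Scope classical_set_scope.
Local Open Scope ring_scope.

(* all_boot also exports a [roots], from fingraph. *)
Local Notation roots := Defs.roots.

(** The axioms only say that a reflection permutes the set of coroots. That it sends the coroot of b
    to the coroot of the reflected root is deduced from finiteness, and this is what makes affine
    reflections compatible with conjugation. Walls are defined topologically, so a simple reflection
    is tied to an affine root through a relatively open piece of a facet; there reducedness leaves
    only a root and its opposite.

    Many notions are chosen values ([elt], [redw], [qX], [XX]), each requiring existence and
    independence of the choice. For [elt] this is simple transitivity on generalized alcoves. Its
    freeness amounts to W meeting Omega trivially, which is why exchange, deletion and generation of
    W by simple reflections are needed.

    Order and length agree deep in the dominant chamber because a translation changes only the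
    constant term of an affine root: for deep l the linear part alone decides the sign, and that
    linear part also decides the order. Unequal parameters are carried by a weight on affine roots
    that is invariant under the group, so weights add under the same condition as lengths. *)

Section Pairing.
Variable n : nat.
Implicit Types (x y : 'rV[int]_n) (z t : 'cV[int]_n).

Lemma pairingDr x z t : pairing x (z + t) = pairing x z + pairing x t.
Proof. by rewrite /pairing mulmxDr mxE. Qed.

Lemma pairingNr x z : pairing x (- z) = - pairing x z.
Proof. by rewrite /pairing mulmxN mxE. Qed.

Lemma pairingBr x z t : pairing x (z - t) = pairing x z - pairing x t.
Proof. by rewrite pairingDr pairingNr. Qed.

Lemma pairingZr c x z : pairing x (c *: z) = c * pairing x z.
Proof. by rewrite /pairing -scalemxAr mxE. Qed.

Lemma pairing0r x : pairing x 0 = 0.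
Proof. by rewrite /pairing mulmx0 mxE. Qed.

Lemma pairingDl x y z : pairing (x + y) z = pairing x z + pairing y z.
Proof. by rewrite /pairing mulmxDl mxE. Qed.

Lemma pairingNl x z : pairing (- x) z = - pairing x z.
Proof. by rewrite /pairing mulNmx mxE. Qed.

Lemma pairingBl x y z : pairing (x - y) z = pairing x z - pairing y z.
Proof. by rewrite pairingDl pairingNl. Qed.

Lemma pairingZl c x z : pairing (c *: x) z = c * pairing x z.
Proof. by rewrite /pairing -scalemxAl mxE. Qed.

Lemma pairing_mulmx x (M : 'M_n) z : pairing x (M *m z) = pairing (x *m M) z.
Proof. by rewrite /pairing mulmxA. Qed.

End Pairing.

(** * Linear forms on V^* and the action of the extended affine Weyl group *)

Section LinearForms.
Variables (R : realType) (P : based_root_datum R).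
Local Notation n := (rk P).
Local Notation V := 'cV[R]_n.
Implicit Types (a b : 'rV[int]_n) (x y z : V) (u v : extW P).

Lemma evalVD a x y : evalV a (x + y) = evalV a x + evalV a y.
Proof. by rewrite /evalV mulmxDr mxE. Qed.

Lemma evalVZ a c x : evalV a (c *: x) = c * evalV a x.
Proof. by rewrite /evalV -scalemxAr mxE. Qed.

Lemma evalVN a x : evalV a (- x) = - evalV a x.
Proof. by rewrite /evalV mulmxN mxE. Qed.

Lemma evalVB a x y : evalV a (x - y) = evalV a x - evalV a y.
Proof. by rewrite evalVD evalVN. Qed.

Lemma evalVNl a x : evalV (- a) x = - evalV a x.
Proof. by rewrite /evalV map_mxN mulNmx mxE. Qed.

Lemma evalV_inV a (mu : 'cV[int]_n) : evalV a (inV mu : V) = (pairing a mu)%:~R.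
Proof. by rewrite /evalV /inV -map_mxM mxE. Qed.

Lemma evalV_act a v x :
  evalV a (act v x) = evalV (a *m lin v) x + (pairing a (trans v))%:~R.
Proof. by rewrite /act evalVD evalV_inV /evalV map_mxM mulmxA. Qed.

Lemma act_mul u v x : act (u * v)%g x = act u (act v x).
Proof.
rewrite /act /= map_mxM /inV map_mxD map_mxM mulmxDr !mulmxA -addrA.
by congr (_ + _); rewrite addrC.
Qed.

Lemma act1 x : act (1%g : extW P) x = x.
Proof. by rewrite /act /= map_mx1 mul1mx /inV map_mx0 addr0. Qed.

Lemma actK v : cancel (act v : V -> V) (act v^-1%g).
Proof. by move=> x; rewrite -act_mul mulVg act1. Qed.

Lemma actKV v : cancel (act v^-1%g : V -> V) (act v).
Proof. by move=> x; rewrite -act_mul mulgV act1. Qed.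

Lemma act_image_mul u v (A : set V) : act (u * v)%g @` A = act u @` (act v @`
  A).
Proof.
apply/seteqP; split => [_ [x Ax <-]|_ [_ [x Ax <-] <-]].
  by exists (act v x); [exists x|rewrite act_mul].
by exists x => //; rewrite act_mul.
Qed.

Lemma near_line x z (Q : set V) : (\forall y \near x, Q y) ->
  exists2 e : R, 0 < e & forall t, `|t| < e -> Q (x + t *: z).
Proof.
move=> /nbhs_ballP[e /= e0 xeQ].
pose M := 1 + \sum_i \sum_j `|z i j|.
have zM i j : `|z i j| < M.
  rewrite /M (bigD1 i) //= (bigD1 j) //=.
  have : 0 <= \sum_(k < n | k != i) \sum_l `|z k l|.
    by do 2!(apply: sumr_ge0 => ? _).
  have : 0 <= \sum_(l < 1 | l != j) `|z i l| by apply: sumr_ge0.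
  lra.
have M0 : 0 < M by rewrite ltr_wpDr //; do 2!(apply: sumr_ge0 => ? _).
exists (e / M); first exact: divr_gt0.
move=> t; rewrite ltr_pdivlMr // => te; apply: xeQ; split => // i j.
rewrite /ball /= !mxE opprD addrA subrr sub0r normrN normrM.
by apply: le_lt_trans te; rewrite ler_wpM2l // ltW.
Qed.

Lemma line_continuous x z : continuous (fun t : R => x + t *: z : V).
Proof.
move=> t B /(@near_line _ z)[e e0 eB]; apply/nbhs_ballP; exists e => //= t'.
rewrite /ball /= distrC => /eB; rewrite -addrA -scalerDl.
by rewrite addrCA subrr addr0.
Qed.

Lemma evalV_continuous a : continuous (evalV a : V -> R).
Proof.
move=> x B /nbhs_ballP[e /= e0 eB].
pose M : R := 1 + \sum_j `|(a 0 j)%:~R|.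
have M0 : 0 < M by rewrite ltr_wpDr //; apply: sumr_ge0.
apply/nbhs_ballP; exists (e / M); first exact: divr_gt0.
move=> y [_ /= xy]; apply: eB; rewrite /ball /= -evalVB /evalV mxE.
apply: (@le_lt_trans _ _ (\sum_j `|(a 0 j)%:~R| * (e / M))).
  apply: le_trans (ler_norm_sum _ _ _) _; apply: ler_sum => j _.
  rewrite normrM mxE ler_wpM2l // !mxE ltW //; exact: (xy j 0).
by rewrite -mulr_suml mulrA ltr_pdivrMr // mulrC ltr_pM2l // /M ltrDr.
Qed.

Lemma near_evalV_lt a x c : evalV a x < c -> \forall y \near x, evalV a y < c.
Proof.
move=> xc; apply: (@evalV_continuous a x [set r | r < c]).
exact: open_nbhs_nbhs.
Qed.

Lemma near_evalV_gt a x c : c < evalV a x -> \forall y \near x, c < evalV a y.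
Proof.
move=> xc; apply: (@evalV_continuous a x [set r | c < r]).
exact: open_nbhs_nbhs.
Qed.

End LinearForms.

(** * Alcoves as polyhedra *)

Section Regular.
Variables (R : realType) (P : based_root_datum R).
Local Notation n := (rk P).
Local Notation V := 'cV[R]_n.
Implicit Types (a b : 'rV[int]_n) (x y z : V).

Definition regular x := forall a (m : int), a \in pos P -> evalV a x <> m%:~R.

Lemma floor_regular x a : regular x -> a \in pos P ->
  (Num.floor (evalV a x))%:~R < evalV a x < (Num.floor (evalV a x))%:~R + 1.
Proof.
move=> rx ap; rewrite lt_neqAle floor_le andbT.
rewrite -[X in _ + X]/(1%:~R) -intrD floorD1_gt andbT.
by apply/eqP => /esym; apply: rx.
Qed.

Lemma connected_avoiding_int (S : set R) (r s : R) (m : int) : connected S ->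
  (forall k : int, ~ S k%:~R) -> S r -> S s -> m%:~R < r -> m%:~R < s.
Proof.
move=> /connected_intervalP Si Sm Sr Ss mr; rewrite ltNge; apply/negP => sm.
by apply: (Sm m); apply: (Si s r) => //; rewrite sm ltW.
Qed.

(** The component is the open box [O]: a connected set avoiding the hyperplanes cannot carry
    [evalV a] across an integer, and [O] is convex. Its closure is the closed box because any point
    of [C], moved slightly toward [x], enters [O]. *)
Lemma alcove_closureE x :
  let U := ~` [set y : V | exists a m, a \in pos P /\ hyp a m y] in
  U x -> closure (connected_component U x) =
  [set y | forall a, a \in pos P -> (Num.floor (evalV a x))%:~R <= evalV a y
                                  <= (Num.floor (evalV a x))%:~R + 1].
Proof.
move=> U Ux; set C := [set _ | _].
pose k a := Num.floor (evalV a x).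
pose O : set V := [set y | forall a, a \in pos P ->
  (k a)%:~R < evalV a y < (k a)%:~R + 1].
have Ox : O x.
  by move=> a ap; apply: floor_regular => // b m bp bx; apply: Ux; exists b, m.
have OU : O `<=` U.
  move=> y Oy [a [m [ap ym]]]; have := Oy a ap; rewrite ym.
  by rewrite -[X in _ + X]/(1%:~R) -intrD !ltr_int; lia.
have seg y : C y -> forall t, 0 <= t < 1 -> O (x + t *: (y - x)).
  move=> Cy t t01 a ap; rewrite evalVD evalVZ evalVB.
  have := Cy a ap; have := Ox a ap; rewrite -/(k a).
  set p := evalV a x; set q := evalV a y; set c := _%:~R.
  by move=> /andP[p1 p2] /andP[q1 q2]; apply/andP; split; nra.
have compO : connected_component U x = O.
  apply/seteqP; split => [y [S [Sx SU Sc] Sy] a ap|y Oy].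
    have Sea : connected (evalV a @` S).
      apply: connected_continuous_connected => //.
      exact/continuous_subspaceT/evalV_continuous.
    have Sm m : ~ (evalV a @` S) m%:~R.
      by move=> [z Sz zm]; apply: (SU _ Sz); exists a, m.
    have fS z : S z -> (evalV a @` S) (evalV a z) by move=> Sz; exists z.
    have /andP[x1 x2] := Ox a ap; apply/andP; split.
      exact: connected_avoiding_int Sea Sm (fS _ Sx) (fS _ Sy) x1.
    rewrite ltNge; apply/negP; rewrite le_eqVlt => /orP[/eqP ky|].
      by apply: (Sm (k a + 1)); rewrite intrD ky; apply: fS.
    rewrite -[X in _ + X]/(1%:~R) -intrD => /(connected_avoiding_int Sea Sm
      (fS _ Sy) (fS _ Sx)).
    by rewrite intrD => /(lt_trans x2); rewrite ltxx.
  pose S := (fun t : R => x + t *: (y - x) : V) @` `[0, 1].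
  have Sy : S y by exists 1;
    rewrite /= ?in_itv /= ?ler01 ?lexx // scale1r addrC subrK.
  apply: (@connected_component_max _ _ S) Sy.
  - by exists 0; rewrite /= ?in_itv /= ?ler01 ?lexx // scale0r addr0.
  - move=> z [t /=]; rewrite in_itv /= => /andP[t0]; rewrite le_eqVlt => t1 <-.
    apply: OU; case/orP: t1 => [/eqP ->|t1].
      by rewrite scale1r addrC subrK.
    apply: seg; last by rewrite t0.
    by move=> a /Oy /andP[? ?]; apply/andP; split; apply: ltW.
  - apply: connected_continuous_connected; first exact: segment_connected.
    exact/continuous_subspaceT/line_continuous.
rewrite compO; apply/seteqP; split => y.
  move=> cy a ap; apply/andP; split; rewrite leNgt; apply/negP.
    move=> /near_evalV_lt /cy[z [/(_ a ap)/andP[z1 _] /ltW]].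
    by rewrite leNgt z1.
  move=> /near_evalV_gt /cy[z [/(_ a ap)/andP[_ z1] /ltW]].
  by rewrite leNgt z1.
move=> Cy B /(@near_line _ _ _ (x - y))[e e0 eB].
pose t := Num.min (e / 2) (1 / 2).
have t0 : 0 < t by rewrite lt_min !divr_gt0.
exists (x + (1 - t) *: (y - x)); split.
  apply: seg => //; have : t <= 1 / 2 by rewrite /t ge_min lexx orbT.
  by move=> ?; apply/andP; split; lra.
have -> : x + (1 - t) *: (y - x) = y + t *: (x - y).
  by rewrite scalerBl scale1r addrA [x + (y - x)]addrC subrK -scalerN opprB.
apply: eB; rewrite gtr0_norm //; apply: le_lt_trans (_ : e / 2 < e).
  by rewrite /t ge_min lexx.
lra.
Qed.

(* A pair (a, c) stands for the closed half-space <a, x> <= c. *)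
Definition halfspaces (I : seq ('rV[int]_n * R)) : set V :=
  [set x | forall i, i \in I -> evalV i.1 x <= i.2].

(* Discard redundant half-spaces until none is left: then some z violates only
   the one that y violates, and the segment from x to z leaves through the
   relative interior of its facet. *)
Lemma halfspaces_facet (I : seq ('rV[int]_n * R)) x y :
  (forall i, i \in I -> evalV i.1 x < i.2) -> ~ halfspaces I y ->
  exists i p, [/\ i \in I, i.2 < evalV i.1 y, evalV i.1 p = i.2 &
    \forall z \near p, evalV i.1 z = i.2 -> halfspaces I z].
Proof.
have [k] := ubnP (size I); elim: k I => // k IH I sI xI yI.
have [[i [iI red]]|irred] := pselect (exists i, i \in I /\
    halfspaces (rem i I) `<=` halfspaces I).
  have rsub j : j \in rem i I -> j \in I by exact: mem_rem.
  have [|||j [p [jI jy jp pI]]] := IH (rem i I).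
  - by move: sI; rewrite size_rem // -ltnS prednK //; case: (I) iI.
  - by move=> j /rsub /xI.
  - by move=> /red.
  exists j, p; split => //; first exact: rsub.
  by apply: filterS pI => z zI /zI /red.
have [i [iI iy]] : exists i, i \in I /\ i.2 < evalV i.1 y.
  apply: contrapT => no; apply: yI => i iI; rewrite leNgt; apply/negP => iy.
  by apply: no; exists i.
have [z [zr zI]] : exists z, halfspaces (rem i I) z /\ ~ halfspaces I z.
  apply: contrapT => no; apply: irred; exists i; split=> // z zr.
  by apply: contrapT => zI; apply: no; exists z.
have memI j : j \in I -> j = i \/ j \in rem i I.
  by rewrite (perm_mem (perm_to_rem iI)) inE => /orP[/eqP|]; [left|right].
have iz : i.2 < evalV i.1 z.
  rewrite ltNge; apply/negP => iz; apply: zI => j /memI[->//|]; exact: zr.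
have ix := xI i iI.
pose t := (i.2 - evalV i.1 x) / (evalV i.1 z - evalV i.1 x).
have d0 : 0 < evalV i.1 z - evalV i.1 x by lra.
have t1 : 0 < t < 1 by rewrite /t divr_gt0 ?ltr_pdivrMr //=; lra.
pose p := x + t *: (z - x).
have pE j : evalV j p = evalV j x + t * (evalV j z - evalV j x).
  by rewrite evalVD evalVZ evalVB.
exists i, p; split => //.
  by rewrite pE /t mulfVK ?gt_eqF // addrCA subrr addr0.
have rp j : j \in rem i I -> evalV j.1 p < j.2.
  move=> jr; have := zr j jr; have := xI j (mem_rem jr); rewrite pE.
  by case/andP: t1; nra.
have : \forall z' \near p, halfspaces (rem i I) z'.
  rewrite /halfspaces /=; elim: (rem i I) rp => [|j J IHJ] rp.
    by near=> z'.
  have jp : evalV j.1 p < j.2 by apply: rp; rewrite mem_head.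
  have Jp j' : j' \in J -> evalV j'.1 p < j'.2.
    by move=> jJ; apply: rp; rewrite inE jJ orbT.
  have := IHJ Jp; apply: filterS2 (near_evalV_lt jp) => z' jz' Jz' j'.
  by rewrite inE => /orP[/eqP ->|/Jz' //]; apply: ltW.
by apply: filterS => z' rz' iz' j /memI[->|/rz' //]; rewrite iz'.
Unshelve. all: by end_near.
Qed.

End Regular.

(** * Roots, coroots and affine roots *)

Section RootDatum.
Variable Phi : root_datum.
Local Notation n := (rk Phi).
Implicit Types (a b : 'rV[int]_n) (w : weyl Phi) (u v : extW Phi).

Lemma mulmx_outer m (x : 'rV[int]_m) (y : 'cV[int]_m) (a : 'rV[int]_m) :
  x *m (y *m a) = pairing x y *: a.
Proof. by rewrite mulmxA [x *m y]mx11_scalar mul_scalar_mx. Qed.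

Lemma outer_mulmx m (x : 'cV[int]_m) (y : 'cV[int]_m) (a : 'rV[int]_m) :
  (y *m a) *m x = pairing a x *: y.
Proof. by rewrite -mulmxA [a *m x]mx11_scalar mul_mx_scalar. Qed.

Lemma mulmx_srefl a b : b *m srefl a = b - pairing b (coroot a) *: a.
Proof. by rewrite /srefl /refl_mx mulmxBr mulmx1 mulmx_outer. Qed.

Lemma srefl_mulmx a (y : 'cV[int]_n) :
  srefl a *m y = y - pairing a y *: coroot a.
Proof. by rewrite /srefl /refl_mx mulmxBl mul1mx outer_mulmx. Qed.

Lemma root_srefl_self a : a \in roots Phi -> a *m srefl a = - a.
Proof.
move=> ra; rewrite mulmx_srefl root_coroot //.
by rewrite (_ : 2 = 1 + 1) // scalerDl scale1r opprD addrA subrr sub0r.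
Qed.

Lemma root_opp a : a \in roots Phi -> - a \in roots Phi.
Proof. by move=> ra; rewrite -root_srefl_self //; apply: root_refl. Qed.

Lemma root_oppE a : (- a \in roots Phi) = (a \in roots Phi).
Proof. by apply/idP/idP => /root_opp //; rewrite opprK. Qed.

Lemma root_neq0 a : a \in roots Phi -> a != 0.
Proof.
by move=> /root_coroot ra; apply: contra_eq_neq ra => ->;
  rewrite /pairing mul0mx mxE.
Qed.

Lemma scale_row_eq0 m (c : int) (x : 'rV[int]_m) :
  (c *: x == 0) = (c == 0) || (x == 0).
Proof.
apply/eqP/orP => [cx|[/eqP ->|/eqP ->]]; [|exact: scale0r|exact: scaler0].
have [|c0] := eqVneq c 0; first by left.
right; apply/eqP/rowP => j; have /rowP/(_ j)/eqP := cx.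
by rewrite !mxE mulf_eq0 (negPf c0) => /eqP.
Qed.

Lemma finite_progression (S : seq 'rV[int]_n) x d :
  (forall N : nat, x + N%:Z *: d \in S) -> d = 0.
Proof.
move=> xS; apply/eqP/contraT => d0.
pose f N := x + N%:Z *: d.
have fI : injective f.
  move=> N M /addrI/eqP;
    rewrite -subr_eq0 -scalerBl scale_row_eq0 (negPf d0) orbF.
  by rewrite subr_eq0 => /eqP[].
have := @uniq_leq_size _ (map f (iota 0 (size S).+1)) S.
rewrite (map_inj_uniq fI) iota_uniq size_map size_iota ltnn; apply => //.
by move=> _ /mapP[N _ ->]; apply: xS.
Qed.

(* Otherwise the reflections in a and b generate infinitely many roots
   a + 2 N (b - a). *)
Lemma root_eq_of_coroot_pairing a b : a \in roots Phi -> b \in roots Phi ->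
  (forall c, c \in roots Phi -> pairing c (coroot a) = pairing c (coroot b)) ->
  a = b.
Proof.
move=> ra rb ab.
have pba : pairing b (coroot a) = 2 by rewrite ab // root_coroot.
have step N : a + N%:Z *: (2 *: (b - a)) \in roots Phi /\
    pairing (a + N%:Z *: (2 *: (b - a))) (coroot a) = 2.
  elim: N => [|N [rN pN]]; first by rewrite scale0r addr0 root_coroot.
  rewrite -(addn1 N) PoszD scalerDl scale1r addrA; set c := a + _ in rN pN *.
  split; last first.
    by rewrite pairingDl pN pairingZl pairingBl pba root_coroot.
  suff -> : c + 2 *: (b - a) = c *m srefl a *m srefl b.
    by do 2!apply: root_refl => //.
  rewrite 2!mulmx_srefl pairingBl pairingZl -!ab // pN root_coroot //.
  by rewrite scalerBr (_ : 2 - 2 * 2 = - 2) // scaleNr opprK addrA addrAC.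
have /eqP := finite_progression (fun N => (step N).1).
by rewrite scale_row_eq0 /= subr_eq0 => /eqP.
Qed.

(** The axiom gives some root [c] whose coroot is the reflected one; the claim is [c = c'].
    Conjugating [srefl b] by [srefl a] and composing with [srefl c'] sends a root x to x + h(x) c',
    and h is unchanged by adding multiples of c' since both coroots pair to 2 with c'. Iteration
    gives an arithmetic progression of roots, so finiteness forces h = 0. *)
Lemma coroot_srefl a b : a \in roots Phi -> b \in roots Phi ->
  coroot (b *m srefl a) = srefl a *m coroot b.
Proof.
move=> ra rb; have /mapP[c rc yc] := coroot_refl ra rb.
rewrite -/(srefl a) in yc; rewrite yc; congr coroot; set c' := b *m srefl a.
have rc' : c' \in roots Phi by exact: root_refl.
have c'c : pairing c' (coroot c) = 2.
  by rewrite -yc /c' /pairing -mulmxA (mulmxA (srefl a)) srefl_sq // mul1mx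
    -/(pairing _ _) root_coroot.
have shift x : x \in roots Phi -> x - pairing x (coroot c) *: c' \in roots Phi.
  move=> rx; have -> : x - pairing x (coroot c) *: c' =
      x *m srefl a *m srefl b *m srefl a.
    rewrite (mulmx_srefl b) mulmxBl -mulmxA srefl_sq // mulmx1 -scalemxAl.
    by rewrite -/c' -pairing_mulmx yc.
  by do 3!apply: root_refl => //.
apply: root_eq_of_coroot_pairing => // x rx; apply/esym/eqP; rewrite -subr_eq0;
  apply/eqP.
pose h x := pairing x (coroot c) - pairing x (coroot c').
have hD y k : h (y + k *: c') = h y.
  by rewrite /h !pairingDl !pairingZl c'c root_coroot // opprD addrACA subrr
    addr0.
have step y : y \in roots Phi -> y + h y *: c' \in roots Phi.
  move=> ry; have := root_refl rc' (shift _ ry);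
    rewrite -/(srefl c') mulmx_srefl.
  rewrite pairingBl pairingZl root_coroot // -addrA -opprD -scalerDl -scaleNr.
  rewrite (_ : - (_ + _) = h y) //.
  by rewrite /h; ring.
suff /(@finite_progression (roots Phi) x)/eqP : forall N : nat,
    x + N%:Z *: (h x *: c') \in roots Phi.
  by rewrite scale_row_eq0 (negPf (root_neq0 rc')) orbF => /eqP.
elim=> [|N IH]; first by rewrite scale0r addr0.
rewrite -(addn1 N) PoszD scalerDl scale1r addrA.
by have := step _ IH; rewrite [in h (_ + _)]scalerA hD.
Qed.

Lemma coroot_opp a : a \in roots Phi -> coroot (- a) = - coroot a.
Proof.
move=> ra; rewrite -root_srefl_self // coroot_srefl // srefl_mulmx root_coroot
  //.
by rewrite (_ : 2 = 1 + 1) // scalerDl scale1r opprD addrA subrr sub0r.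
Qed.

Lemma root_coroot_weyl a w : a \in roots Phi ->
  a *m w \in roots Phi /\ w *m coroot (a *m w) = coroot a.
Proof.
case: w => M /= /asboolP[s + ->].
elim: s a => [|b s IH] a sr ra; first by rewrite big_nil mulmx1 mul1mx.
have rb : b \in roots Phi by apply: sr; rewrite mem_head.
rewrite big_cons -[_ * _]/(_ *m _) (mulmxA a) -(mulmxA (srefl b)).
have [||r1 ->] := IH (a *m srefl b).
- by move=> c cs; apply: sr; rewrite inE cs orbT.
- exact: root_refl.
by split => //; rewrite coroot_srefl // mulmxA srefl_sq // mul1mx.
Qed.

Lemma weyl_mulVmx w : (w^-1)%g *m w = 1%:M.
Proof. exact: (congr1 (@weyl_val Phi) (mulVg w)). Qed.

Lemma weyl_mulmxV w : w *m (w^-1)%g = 1%:M.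
Proof. exact: (congr1 (@weyl_val Phi) (mulgV w)). Qed.

Lemma root_weyl a w : a \in roots Phi -> a *m w \in roots Phi.
Proof. by move=> /(root_coroot_weyl w)[]. Qed.

Lemma coroot_weyl a w : a \in roots Phi ->
  coroot (a *m w) = (w^-1)%g *m coroot a.
Proof.
move=> /(root_coroot_weyl w)[_ aE].
by rewrite -[in RHS]aE mulmxA weyl_mulVmx mul1mx.
Qed.

Lemma weyl_srefl a : a \in roots Phi -> srefl a \in @weyl_pred Phi.
Proof.
move=> ra; apply/asboolP; exists [:: a]; last by rewrite big_seq1.
by move=> b; rewrite inE => /eqP ->.
Qed.

Lemma extW_eq u v : lin u = lin v :> 'M_n -> trans u = trans v -> u = v.
Proof. by case: u v => [u mu] [v nu] /= /val_inj -> ->. Qed.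

End RootDatum.

Section AffineRoots.
Variable Phi : root_datum.
Local Notation n := (rk Phi).

(* The pair (a, m) stands for the affine function x |-> <a, x> + m, on which
   the extended affine Weyl group acts by precomposition. *)
Local Notation affine := ('rV[int]_n * int)%type.
Implicit Types (b : affine) (u v : extW Phi).

Definition aff_act b v : affine :=
  (b.1 *m lin v, b.2 + pairing b.1 (trans v)).

(** The zero set of [b] is the hyperplane H with constant [- b.2], hence the sign. If [b.1] is not a
    root, [insubd] may fall back to 1. *)
Definition arefl b : extW Phi :=
  ExtW (insubd (1%g : weyl Phi) (srefl b.1)) (- b.2 *: coroot b.1).

Lemma lin_arefl b : b.1 \in roots Phi -> lin (arefl b) = srefl b.1 :> 'M_n.
Proof. by move=> rb; rewrite insubdK //; apply: weyl_srefl. Qed.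

Lemma aff_actM b u v : aff_act b (u * v)%g = aff_act (aff_act b u) v.
Proof. by rewrite /aff_act /= pairingDr pairing_mulmx mulmxA addrA. Qed.

Lemma aff_act1 b : aff_act b 1%g = b.
Proof. by case: b => a m;
  rewrite /aff_act /= mulmx1 /pairing mulmx0 mxE addr0. Qed.

Lemma aff_actK v : cancel (aff_act^~ v) (aff_act^~ v^-1%g).
Proof. by move=> b; rewrite -aff_actM mulgV aff_act1. Qed.

Lemma aff_actKV v : cancel (aff_act^~ v^-1%g) (aff_act^~ v).
Proof. by move=> b; rewrite -aff_actM mulVg aff_act1. Qed.

Lemma aff_act_inj v : injective (aff_act^~ v).
Proof. exact: can_inj (aff_actK v). Qed.

Lemma aff_actN b v : aff_act (- b) v = - aff_act b v.
Proof. by rewrite /aff_act /= mulNmx pairingNl -opprD. Qed.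

Lemma aff_act_root b v : (aff_act b v).1 \in roots Phi = (b.1 \in roots Phi).
Proof.
apply/idP/idP => /=; last exact: root_weyl.
by move=> /(root_weyl (lin v)^-1%g); rewrite -mulmxA weyl_mulmxV mulmx1.
Qed.

Lemma aff_act_arefl b : b.1 \in roots Phi -> aff_act b (arefl b) = - b.
Proof.
move=> rb; rewrite /aff_act lin_arefl // root_srefl_self //= pairingZr.
by rewrite root_coroot //; congr (_, _); ring.
Qed.

Lemma arefl_conj b v : b.1 \in roots Phi ->
  arefl (aff_act b v) = (v^-1 * arefl b * v)%g.
Proof.
move=> rb; have rbv : (aff_act b v).1 \in roots Phi by rewrite aff_act_root.
have -> : v^-1%g = ExtW (lin v)^-1%g (- ((lin v)^-1%g *m trans v)) by [].
apply: extW_eq.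
  rewrite lin_arefl //= lin_arefl // /srefl /refl_mx coroot_weyl // mulmxBr
    mulmx1.
  by rewrite mulmxBl weyl_mulVmx !mulmxA.
rewrite /= lin_arefl // coroot_weyl // -mulmxA srefl_mulmx mulmxBr.
by rewrite -!scalemxAr addrACA addNr add0r -scaleNr -scalerDl opprD.
Qed.

Lemma aff_rootN b : ((- b).1 \in roots Phi) = (b.1 \in roots Phi).
Proof. exact: root_oppE. Qed.

Lemma arefl_opp b : b.1 \in roots Phi -> arefl (- b) = arefl b.
Proof.
case: b => a m /= ra; rewrite -[- (a, m)]/(- a, - m).
apply: extW_eq => /=; last by rewrite coroot_opp // scalerN -scaleNr opprK.
rewrite !insubdK ?weyl_srefl ?root_oppE //.
by rewrite /srefl /refl_mx coroot_opp // mulmxN mulNmx opprK.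
Qed.

Lemma arefl_invol b : b.1 \in roots Phi -> (arefl b * arefl b)%g = 1%g.
Proof.
move=> rb; apply: extW_eq; rewrite /= lin_arefl // ?srefl_sq //.
rewrite srefl_mulmx pairingZr root_coroot // -!scalerBl -!scalerDl.
by rewrite (_ : _ + _ = 0) ?scale0r //; ring.
Qed.

Lemma arefl_inv b : b.1 \in roots Phi -> (arefl b)^-1%g = arefl b.
Proof. by move=> rb; apply/mulg1_eq/arefl_invol. Qed.

End AffineRoots.

Arguments aff_act {Phi} b v : simpl never.

(** * Positive affine roots, facets of A_f and simple reflections *)

Section Positivity.
Variables (R : realType) (P : based_root_datum R).
Local Notation n := (rk P).
Local Notation V := 'cV[R]_n.
Local Notation affine := ('rV[int]_n * int)%type.
Implicit Types (a : 'rV[int]_n) (b : affine) (x y z : V) (u v : extW P).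

Lemma pos_root a : a \in pos P -> a \in roots P.
Proof. by case: (posP P) => g [_ ->] /andP[]. Qed.

Lemma pos_opp a : a \in roots P -> (- a \in pos P) = (a \notin pos P).
Proof.
case: (posP P) => g [gN0 posE] ra; rewrite !posE root_oppE ra /=.
rewrite -/(evalV _ _) -/(evalV _ _) evalVNl oppr_gt0 -leNgt le_eqVlt.
by have /negPf := gN0 a ra; rewrite -/(evalV _ _) => ->.
Qed.

Lemma seq_bounded (F : realDomainType) (T : eqType) (S : seq T) (f : T -> F) :
  exists2 M, 0 < M & forall i, i \in S -> f i < M.
Proof.
elim: S => [|i S [M M0 fM]]; first by exists 1.
exists (Num.max M (f i + 1)); first by rewrite lt_max M0.
by move=> j; rewrite inE lt_max => /orP[/eqP ->|/fM ->//];
  rewrite ltrDl ltr01 orbT.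
Qed.

Lemma Af_interior : exists x : V, forall a, a \in pos P -> 0 < evalV a x < 1.
Proof.
have [g [_ posE]] := posP P.
have [M M0 gM] := seq_bounded (pos P) (fun a => evalV a g).
exists (M^-1 *: g) => a ap; have ag : 0 < evalV a g.
  by move: ap; rewrite posE => /andP[].
by rewrite evalVZ mulr_gt0 ?invr_gt0 //= mulrC ltr_pdivrMr // mul1r gM.
Qed.

Definition x0 : V := sval (cid Af_interior).

Lemma x0P a : a \in pos P -> 0 < evalV a x0 < 1.
Proof. exact: (svalP (cid Af_interior) a). Qed.

Lemma x0_Af : @Af R P x0.
Proof. by move=> a /x0P /andP[? ?]; rewrite !ltW. Qed.

(** The vector gamma defining [pos P] is real, so a large multiple of it is rounded down
    coordinatewise. Rounding changes the pairing with a by at most the sum of the absolute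
    coordinates of a, which dictates the factor [M]. *)
Lemma deep_coweight (N : int) :
  exists mu : 'cV[int]_n, forall a, a \in pos P -> N <= pairing a mu.
Proof.
suff [mu mu1] : exists mu : 'cV[int]_n, forall a, a \in pos P ->
  1 <= pairing a mu.
  exists (`|N| *: mu) => a /mu1 am; rewrite pairingZr.
  by apply: le_trans (ler_norm N) _; rewrite ler_peMr.
have [g [_ posE]] := posP P.
have [M M0 gM] := seq_bounded (pos P)
  (fun a => (\sum_i `|(a 0 i)%:~R|) / evalV a g).
exists (\col_i Num.floor (M * g i 0)) => a ap; rewrite -gtz0_ge1.
have ag : 0 < evalV a g by move: ap; rewrite posE => /andP[].
rewrite -(ltr_int R) -[(pairing _ _)%:~R]evalV_inV.
have -> : inV (\col_i Num.floor (M * g i 0)) =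
    M *: g - \col_i (M * g i 0 - (Num.floor (M * g i 0))%:~R).
  by apply/colP => i; rewrite !mxE opprB addrC subrK.
rewrite evalVB evalVZ subr_gt0; have := gM a ap; rewrite ltr_pdivrMr //.
apply: le_lt_trans; rewrite /evalV mxE; apply: ler_sum => i _; rewrite !mxE.
have /andP[f1 f2] := floor_itv (M * g i 0).
apply: le_trans (ler_norm _) _;
  rewrite normrM ler_piMr // ger0_norm ?subr_ge0 //.
by rewrite lerBlDl ltW // -[X in _ + X]/(1%:~R) -intrD.
Qed.

Definition aff_eval b x : R := evalV b.1 x + b.2%:~R.

Lemma aff_eval_act b v x : aff_eval (aff_act b v) x = aff_eval b (act v x).
Proof. by rewrite /aff_eval evalV_act intrD /= addrAC addrA. Qed.

Lemma aff_evalN b x : aff_eval (- b) x = - aff_eval b x.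
Proof. by rewrite /aff_eval /= evalVNl intrN opprD. Qed.

(* The affine roots taking positive values on the interior of A_f. *)
Definition aff_pos b := (b.1 \notin pos P)%:Z <= b.2.

Lemma aff_posN b : b.1 \in roots P -> aff_pos (- b) = ~~ aff_pos b.
Proof.
case: b => a m; rewrite /aff_pos /= => /pos_opp ->.
by case: (a \in pos P) => /=; lia.
Qed.

Lemma aff_eval_ge0 b x : b.1 \in roots P -> aff_pos b -> Af x ->
  0 <= aff_eval b x.
Proof.
case: b => a m; rewrite /aff_pos /aff_eval /= => ra.
have [ap|ap] := boolP (a \in pos P) => /= m0 Ax.
  by rewrite addr_ge0 ?ler0z //; have /andP[] := Ax a ap.
have nap : - a \in pos P by rewrite pos_opp.
have := Ax _ nap; rewrite evalVNl => /andP[_ ?].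
have : 1 <= m%:~R :> R by rewrite ler1z.
lra.
Qed.

Lemma aff_eval_x0 b : b.1 \in roots P -> (0 < aff_eval b x0) = aff_pos b.
Proof.
have gt0 c : c.1 \in roots P -> aff_pos c -> 0 < aff_eval c x0.
  case: c => a m; rewrite /aff_pos /aff_eval /= => ra.
  have [ap|ap] := boolP (a \in pos P) => /= m0.
    by rewrite ltr_wpDr ?ler0z //; have /andP[] := x0P ap.
  have nap : - a \in pos P by rewrite pos_opp.
  have := x0P nap; rewrite evalVNl => /andP[_ ?].
  have : 1 <= m%:~R :> R by rewrite ler1z.
  lra.
move=> rb; have [|nb] := boolP (aff_pos b); first exact: gt0.
have := gt0 (- b); rewrite aff_rootN aff_posN // nb aff_evalN oppr_gt0.
by move=> /(_ rb isT) /ltW; rewrite leNgt => /negbTE.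
Qed.

Lemma root_eq_of_kernel a c : a \in roots P -> c \in roots P ->
  (forall mu, pairing a mu = 0 -> pairing c mu = 0) -> c = a \/ c = - a.
Proof.
move=> ra rc ac; suff E : 2 *: c = pairing c (coroot a) *: a.
  have [->|->] := root_reduced rc ra (isT : 2 != 0 :> int) E; first by left.
  by rewrite opprK; right.
apply/rowP => j; rewrite !mxE; apply/eqP; rewrite -subr_eq0; apply/eqP.
(* Twice the projection of the j-th basis vector to the kernel of a along the coroot; the factor 2
   keeps it integral. *)
pose z : 'cV[int]_n := 2 *: delta_mx j 0 - a 0 j *: coroot a.
have zE d : pairing d z = 2 * d 0 j - a 0 j * pairing d (coroot a).
  rewrite pairingBr !pairingZr; congr (_ * _ - _).
  by rewrite /pairing -colE mxE.
by rewrite mulrC [_ * a 0 j]mulrC -(mulrC 2) -zE ac // zE root_coroot //; ring.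
Qed.

Lemma act_arefl b x : b.1 \in roots P ->
  act (arefl b) x = x - aff_eval b x *: inV (coroot b.1).
Proof.
move=> rb; rewrite /act lin_arefl //= /srefl /refl_mx.
have -> : map_mx intr (1%:M - coroot b.1 *m b.1) =
    1%:M - inV (coroot b.1) *m map_mx intr b.1 :> 'M[R]_n.
  by rewrite map_mxB map_mx1 map_mxM.
rewrite mulmxBl mul1mx -mulmxA [map_mx intr b.1 *m x]mx11_scalar mul_mx_scalar.
rewrite -/(evalV _ _) /inV map_mxZ -addrA; congr (_ + _).
by rewrite /= intrN scaleNr -opprD -scalerDl.
Qed.

(** From p one may move both ways along any mu killed by [b.1] without leaving the zero set of b. As
    c vanishes at p and stays nonnegative, [c.1] kills mu too, so [c.1] is [b.1] up to sign; the
    common zero p fixes the constant. *)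
Lemma affine_root_facet b c p : b.1 \in roots P -> c.1 \in roots P ->
  aff_eval b p = 0 -> aff_eval c p = 0 ->
  (\forall y \near p, aff_eval b y = 0 -> 0 <= aff_eval c y) ->
  c = b \/ c = - b.
Proof.
move=> rb rc bp cp bc; have [|c1|c1] := root_eq_of_kernel rb rc.
- move=> mu bmu; have [e e0 ep] := near_line (inV mu) bc.
  have evD d t : aff_eval d (p + t *: inV mu) =
      aff_eval d p + t * (pairing d.1 mu)%:~R.
    by rewrite /aff_eval evalVD evalVZ evalV_inV addrAC.
  have ge0 t : `|t| < e -> 0 <= t * (pairing c.1 mu)%:~R.
    by move=> /ep; rewrite !evD bp bmu cp mulr0 add0r add0r; apply.
  apply/eqP; rewrite -(intr_eq0 R) eq_le.
  have e2 : `|e / 2| < e by rewrite ger0_norm; lra.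
  have := ge0 (e / 2) e2; have := ge0 (- (e / 2)); rewrite normrN => /(_ e2).
  by move=> ? ?; apply/andP; split; nra.
- left; case: b c c1 bp cp {rb rc bc} => [a m] [_ k] /= ->.
  by rewrite /aff_eval /= => <- /addrI/intr_inj ->.
right; case: b c c1 bp cp {rb rc bc} => [a m] [_ k] /= ->.
rewrite /aff_eval /= evalVNl => am ak; congr (_, _); apply: (@intr_inj R).
by rewrite intrN; lra.
Qed.

Definition simple_root_of (s : Sa P) b :=
  [/\ b.1 \in roots P, aff_pos b, val s = arefl b &
      exists2 p : V, aff_eval b p = 0 &
        \forall y \near p, aff_eval b y = 0 -> Af y].

Lemma simple_root_exists (s : Sa P) : exists b, simple_root_of s b.
Proof.
case: s => s ss; have /asboolP[a [m [ap [p pm pAf] [sl st]]]] := ss.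
have ra := pos_root ap.
have sE : s = arefl (a, - m).
  by apply: extW_eq; rewrite ?lin_arefl //= opprK.
have pE y : aff_eval (a, - m) y = evalV a y - m%:~R by rewrite /aff_eval intrN.
have rNa : (- (a, - m)).1 \in roots P by rewrite /= root_oppE.
have [sp|sp] := boolP (aff_pos (a, - m)).
  exists (a, - m); split => //; exists p; first by rewrite pE pm subrr.
  by apply: filterS pAf => y yA /eqP; rewrite pE subr_eq0 => /eqP.
exists (- (a, - m)); split => //.
- by rewrite aff_posN.
- by rewrite arefl_opp.
exists p; first by rewrite aff_evalN pE pm subrr oppr0.
by apply: filterS pAf => y yA /eqP;
  rewrite aff_evalN oppr_eq0 pE subr_eq0 => /eqP.
Qed.

Definition simple_root (s : Sa P) : affine := sval (cid (simple_root_exists s)).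

Lemma simple_rootP s : simple_root_of s (simple_root s).
Proof. exact: (svalP (cid (simple_root_exists s))). Qed.

Lemma simple_root_root s : (simple_root s).1 \in roots P.
Proof. by have [] := simple_rootP s. Qed.

Lemma simple_root_pos s : aff_pos (simple_root s).
Proof. by have [] := simple_rootP s. Qed.

Lemma val_SaE s : val s = arefl (simple_root s).
Proof. by have [] := simple_rootP s. Qed.

Lemma simple_root_act s : aff_act (simple_root s) (val s) = - simple_root s.
Proof. by rewrite val_SaE aff_act_arefl // simple_root_root. Qed.

Lemma Sa_invol (s : Sa P) : (val s * val s)%g = 1%g.
Proof. by rewrite val_SaE arefl_invol // simple_root_root. Qed.

Lemma SaV (s : Sa P) : (val s)^-1%g = val s.
Proof. by rewrite val_SaE arefl_inv // simple_root_root. Qed.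

Lemma act_facet s p : aff_eval (simple_root s) p = 0 -> act (val s) p = p.
Proof.
by move=> sp; rewrite val_SaE act_arefl ?simple_root_root // sp scale0r subr0.
Qed.

(** At a facet point p, fixed by s, b is nonnegative by positivity and nonpositive because its image
    under s is negative. So b vanishes at p, and [affine_root_facet] applies. *)
Lemma simple_root_unique s b : b.1 \in roots P -> aff_pos b ->
  ~~ aff_pos (aff_act b (val s)) -> b = simple_root s.
Proof.
move=> rb b0 bs; have [ra a0 _ [p ap pA]] := simple_rootP s.
have Ap : Af p by apply: nbhs_singleton pA _.
have bp : aff_eval b p = 0.
  apply/eqP; rewrite eq_le aff_eval_ge0 // andbT.
  rewrite -(act_facet ap) -aff_eval_act -oppr_ge0 -aff_evalN.
  by apply: aff_eval_ge0; rewrite ?aff_rootN ?aff_posN ?aff_act_root.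
have [] // := affine_root_facet ra rb ap bp.
  by apply: filterS pA => y yA ay; apply: aff_eval_ge0 => //; apply: yA.
by move=> bE; move: b0; rewrite bE aff_posN ?a0.
Qed.

Lemma outside_Af y : ~ Af y -> exists s, aff_eval (simple_root s) y < 0.
Proof.
pose I := [seq (- a, 0) | a <- pos P] ++ [seq (a, 1) | a <- pos P] : seq (_ *
  R).
have AfE : @Af R P = halfspaces I.
  apply/seteqP; split => x Ax.
    move=> i; rewrite mem_cat => /orP[] /mapP[a ap ->] /=.
      by rewrite evalVNl oppr_le0; have /andP[] := Ax a ap.
    by have /andP[] := Ax a ap.
  move=> a ap; apply/andP; split.
    rewrite -oppr_le0 -evalVNl; apply: (Ax (- a, 0)).
    by rewrite mem_cat (map_f (fun a => (- a, 0))).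
  by apply: (Ax (a, 1)); rewrite mem_cat (map_f (fun a => (a, 1))) // orbT.
have Ix i : i \in I -> evalV i.1 x0 < i.2.
  rewrite mem_cat => /orP[] /mapP[a /x0P /andP[? ?] ->] //=.
  by rewrite evalVNl oppr_lt0.
rewrite AfE => /(halfspaces_facet Ix)[i [p [iI iy ip pI]]].
(* The two families of half-spaces give m = 0 and m = 1. In the first case (a, - m) is positive on
   A_f, in the second its opposite is. *)
have [a [m [ap yb pb pA]]] : exists a (m : int), [/\ a \in pos P, wall a m,
    aff_pos (a, - m) -> evalV a y < m%:~R &
    ~~ aff_pos (a, - m) -> m%:~R < evalV a y].
  move: iI; rewrite mem_cat => /orP[] /mapP[a ap iE]; exists a.
    exists 0; split; rewrite // /aff_pos /= ?ap ?oppr0 //.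
      exists p; first by move: ip; rewrite iE /= evalVNl /hyp /= => /eqP;
        rewrite oppr_eq0 => /eqP.
      rewrite AfE; apply: filterS pI => z zI az; apply: zI.
      by rewrite iE /= evalVNl az oppr0.
    by move=> _; move: iy; rewrite iE /= evalVNl oppr_gt0.
  exists 1; split; rewrite // /aff_pos /= ?ap //.
    exists p; first by move: ip; rewrite iE.
    by rewrite AfE; apply: filterS pI => z zI az; apply: zI; rewrite iE.
  by move=> _; move: iy; rewrite iE.
have ra : (a, - m).1 \in roots P by exact: pos_root.
have rNa : (- (a, - m)).1 \in roots P by rewrite /= root_oppE.
have ss : simple (arefl (a, - m)).
  apply/asboolP; exists a, m; split => //.
  by split; [rewrite lin_arefl|rewrite /= opprK].
pose s : Sa P := exist _ (arefl (a, - m)) ss.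
have sE : aff_act (a, - m) (val s) = - (a, - m) by rewrite aff_act_arefl.
exists s; have [sp|sp] := boolP (aff_pos (a, - m)).
  have <- : (a, - m) = simple_root s.
    by apply: simple_root_unique; rewrite ?sE ?aff_posN ?negbK.
  by rewrite /aff_eval /= intrN subr_lt0 pb.
have <- : - (a, - m) = simple_root s.
  by apply: simple_root_unique; rewrite ?aff_actN ?sE ?opprK ?aff_posN.
by rewrite aff_evalN oppr_lt0 /aff_eval /= intrN subr_gt0 pA.
Qed.

End Positivity.

Arguments x0 {R P}.
Arguments x0_Af {R P}.

(** * Lengths and inversions *)

Section Length.
Variables (R : realType) (P : based_root_datum R).
Local Notation n := (rk P).
Local Notation V := 'cV[R]_n.
Local Notation affine := ('rV[int]_n * int)%type.
Implicit Types (b c : affine) (x y z : V) (u v g : extW P) (s : Sa P).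
Implicit Types (ws : seq (Sa P)).

(** For fixed a, both positivity of (a, m) and negativity of its image are bounds on m. This is the
    number of integers between them; the bounds may cross, whence the maximum with 0. *)
Definition num_invs v (a : 'rV[int]_n) : nat :=
  absz (Num.max 0 ((a *m lin v \notin pos P)%:Z - pairing a (trans v)
                   - (a \notin pos P)%:Z)).

(* The positive affine roots made negative by [v]; their zero sets are the
   hyperplanes that separate A_f from v A_f. *)
Definition invs v : seq affine :=
  [seq (a, (a \notin pos P)%:Z + i%:Z) | a <- undup (roots P),
                                         i <- iota 0 (num_invs v a)].

Lemma invs_uniq v : uniq (invs v).
Proof.
apply: allpairs_uniq_dep; first exact: undup_uniq.
  by move=> a _; apply: iota_uniq.
move=> [a i] [c j] _ _ /= [-> ]; case: (c \notin pos P) => /= ij;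
  by congr existT; lia.
Qed.

Lemma mem_invs v b :
  (b \in invs v) = [&& b.1 \in roots P, aff_pos b & ~~ aff_pos (aff_act b v)].
Proof.
case: b => a m; rewrite /aff_pos /=; apply/allpairsPdep/and3P.
  move=> [c [i [cr]]]; rewrite mem_iota mem_undup /num_invs in cr *.
  by move=> ic [-> ->]; split => //=; move: ic;
    case: (c \notin _) (c *m _ \notin _) => [] []; lia.
rewrite -ltNge => -[ra a0 am].
exists a, (absz (m - (a \notin pos P)%:Z)); split; rewrite ?mem_undup //.
  rewrite mem_iota /num_invs; move: a0 am.
  by case: (a \notin _) (a *m _ \notin _) => [] []; lia.
by congr (_, _); move: a0; case: (a \notin _); lia.
Qed.

(** The hypothesis says that v undoes no inversion of u, which is the condition for lengths to
    add. *)
Lemma invs_mul u v : (forall b, b \in invs u ->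
  ~~ aff_pos (aff_act b (u * v)%g)) ->
  perm_eq (invs (u * v)%g) (invs u ++ map (aff_act^~ u^-1%g) (invs v)).
Proof.
move=> uv; apply: uniq_perm; rewrite ?invs_uniq //.
  rewrite cat_uniq invs_uniq (map_inj_uniq (aff_act_inj (v := _))) invs_uniq.
  rewrite andbT; apply/hasPn => _ /mapP[b + ->]; rewrite !mem_invs.
  by case/and3P => _ b0 _; rewrite aff_actKV b0 !andbF.
move=> b; rewrite mem_cat; apply/idP/orP.
  rewrite !mem_invs => /and3P[rb b0 buv]; rewrite rb b0 /=.
  have [bu|] := boolP (aff_pos (aff_act b u)); last by left.
  right; apply/mapP; exists (aff_act b u); last by rewrite aff_actK.
  by rewrite mem_invs aff_act_root rb bu -aff_actM.
case=> [bu|/mapP[c + ->]].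
  by move: (bu) (uv _ bu); rewrite !mem_invs => /and3P[-> -> _] ->.
rewrite !mem_invs => /and3P[rc c0 cv];
  rewrite aff_act_root rc aff_actM aff_actKV cv.
rewrite /= andbT; apply/contraT => cu.
(* Were the pulled-back root negative, its opposite would be an inversion of u that v undoes. *)
have : - aff_act c u^-1%g \in invs u.
  rewrite mem_invs aff_actN aff_actKV !aff_posN ?c0 ?cu ?aff_act_root //.
  by rewrite aff_rootN aff_act_root rc.
move=> /uv; rewrite aff_actN aff_actM aff_actKV aff_posN ?negbK ?aff_act_root
  //.
by rewrite (negPf cv).
Qed.

Definition ell v := size (invs v).

Lemma ell_mul u v : (forall b, b \in invs u ->
  ~~ aff_pos (aff_act b (u * v)%g)) ->
  ell (u * v)%g = (ell u + ell v)%N.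
Proof. by move=> /invs_mul/perm_size; rewrite size_cat size_map. Qed.

Lemma invs_inv v :
  perm_eq (invs v^-1%g) (map (fun b => - aff_act b v) (invs v)).
Proof.
have inj : injective (fun b => - aff_act b v).
  by move=> b c /oppr_inj /aff_act_inj.
apply: uniq_perm; rewrite ?(map_inj_uniq inj) ?invs_uniq // => b.
apply/idP/mapP => [|[c + ->]]; rewrite !mem_invs.
  move=> /and3P[rb b0 bv]; exists (- aff_act b v^-1%g).
    rewrite mem_invs aff_actN aff_actKV !aff_posN ?aff_act_root //.
    by rewrite aff_rootN aff_act_root rb b0 bv.
  by rewrite aff_actN aff_actKV opprK.
move=> /and3P[rc c0 cv]; rewrite aff_actN aff_actK !aff_posN ?aff_act_root //.
by rewrite aff_rootN aff_act_root rc c0 cv.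
Qed.

Lemma ell_inv v : ell v^-1%g = ell v.
Proof. by rewrite /ell (perm_size (invs_inv v)) size_map. Qed.

Lemma Af_aff_posP y :
  Af y <-> (forall b, b.1 \in roots P -> aff_pos b -> 0 <= aff_eval b y).
Proof.
split=> [Ay b rb b0|b0 a ap]; first exact: aff_eval_ge0.
have ra := pos_root ap; have := b0 (a, 0); have := b0 (- a, 1).
rewrite /aff_eval /aff_pos /= evalVNl root_oppE pos_opp // ra ap addr0 => A B.
by rewrite B //= -subr_ge0 addrC A.
Qed.

(** A_f is where all positive affine roots are nonnegative, so an element without inversions maps
    A_f into itself. Its inverse has no inversions either, which upgrades inclusion to equality;
    conversely the interior point [x0] detects any inversion. *)
Lemma invs_stabAf g : stabAf g = (invs g == [::]).
Proof.
have sub v : invs v = [::] -> forall x, Af x -> Af (act v x).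
  move=> v0 x Ax; apply/Af_aff_posP => b rb b0; rewrite -aff_eval_act.
  apply: aff_eval_ge0; rewrite ?aff_act_root //.
  have : b \notin invs v by rewrite v0.
  by rewrite mem_invs rb b0 negbK.
apply/asboolP/eqP => [gA|g0].
  apply: size0nil; apply/eqP; rewrite -leqn0 leqNgt -has_predT.
  apply/negP => /hasP[b + _]; rewrite mem_invs => /and3P[rb b0 bg].
  have : 0 < aff_eval (- aff_act b g) x0.
    by rewrite aff_eval_x0 ?aff_rootN ?aff_posN ?aff_act_root.
  rewrite aff_evalN oppr_gt0 aff_eval_act ltNge aff_eval_ge0 //.
  by rewrite -gA; exists x0 => //; apply: x0_Af.
have gV0 : invs g^-1%g = [::].
  by apply: size0nil; rewrite -/(ell _) ell_inv /ell g0.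
apply/seteqP; split => [_ [x Ax <-]|x Ax]; first exact: sub.
by exists (act g^-1%g x); [exact: sub|rewrite actKV].
Qed.

Lemma ell_eq0 v : ell v = 0%N -> stabAf v.
Proof. by move=> /size0nil v0; rewrite invs_stabAf v0. Qed.

Lemma invs_mulOmega u g : stabAf g -> perm_eq (invs (u * g)%g) (invs u).
Proof.
rewrite invs_stabAf => /eqP g0; rewrite -[invs u]cats0.
have := @invs_mul u g; rewrite g0 /=; apply => b.
rewrite mem_invs => /and3P[rb b0 bu]; apply/negP; rewrite aff_actM => bug.
have : - aff_act b u \in invs g.
  by rewrite mem_invs aff_actN aff_rootN !aff_posN ?bu ?bug ?aff_act_root // rb.
by rewrite g0.
Qed.

Lemma ell_mulOmega u g : stabAf g -> ell (u * g)%g = ell u.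
Proof. by move=> /(invs_mulOmega u)/perm_size. Qed.

(** The affine root tested here is nonnegative on u A_f and vanishes on the wall shared with u s
    A_f. It is positive on the interior of A_f exactly when crossing that wall leads away from
    A_f. *)
Definition ascent u s := aff_pos (aff_act (simple_root s) u^-1%g).

Lemma ascent_mul u s : ascent (u * val s)%g s = ~~ ascent u s.
Proof.
rewrite /ascent invgM SaV aff_actM simple_root_act aff_actN aff_posN //.
by rewrite aff_act_root simple_root_root.
Qed.

Lemma invs_simple s : invs (val s) = [:: simple_root s].
Proof.
apply/perm_small_eq; first by [].
apply: uniq_perm; rewrite ?invs_uniq // => b; rewrite mem_invs inE.
apply/and3P/eqP => [[rb b0 bs]|->]; first exact: simple_root_unique.
rewrite simple_root_act aff_posN ?simple_root_root //.
by rewrite simple_root_pos.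
Qed.

Lemma invs_ascent u s : ascent u s ->
  perm_eq (invs (u * val s)%g) (rcons (invs u) (aff_act (simple_root s)
    u^-1%g)).
Proof.
move=> us; have := @invs_mul u (val s).
rewrite invs_simple /= cats1; apply => b; rewrite mem_invs => /and3P[rb b0 bu].
apply/negP; rewrite aff_actM => bus.
have rbu : (- aff_act b u).1 \in roots P.
  by rewrite aff_rootN aff_act_root.
have := @simple_root_unique _ _ s (- aff_act b u) rbu.
rewrite aff_actN !aff_posN ?aff_act_root // bu bus => /(_ isT isT) bE.
by move: us; rewrite /ascent -bE aff_actN aff_actK aff_posN // b0.
Qed.

Lemma ell_ascent u s : ascent u s -> ell (u * val s)%g = (ell u).+1.
Proof. by move=> /invs_ascent/perm_size; rewrite size_rcons. Qed.

Lemma ell_descent u s : ~~ ascent u s -> ell u = (ell (u * val s)%g).+1.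
Proof.
by rewrite -ascent_mul => /ell_ascent <-; rewrite -mulgA Sa_invol mulg1.
Qed.

Lemma ell_mul_leq u s : (ell (u * val s)%g <= (ell u).+1)%N.
Proof.
by have [/ell_ascent ->//|/ell_descent ->] := boolP (ascent u s); rewrite ltnW.
Qed.

(** An inversion of the inverse of v puts v^-1 x0 outside A_f. Some simple affine root is then
    negative there, so pulling it back by v^-1 gives a root negative at [x0]. *)
Lemma descent_exists v : ell v != 0%N -> exists s, ~~ ascent v s.
Proof.
rewrite -ell_inv -lt0n -has_predT => /hasP[b + _].
rewrite mem_invs => /and3P[rb b0 bv].
have : 0 < aff_eval (- aff_act b v^-1%g) x0.
  rewrite aff_eval_x0 ?aff_posN ?aff_rootN ?aff_act_root //.
rewrite aff_evalN oppr_gt0 aff_eval_act => bx.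
have [|s sx] := @outside_Af _ _ (act v^-1%g x0).
  by move=> /(aff_eval_ge0 rb b0); rewrite leNgt bx.
exists s; apply/negP => us; have := aff_eval_ge0 _ us x0_Af.
by rewrite aff_act_root simple_root_root aff_eval_act leNgt sx => /(_ isT).
Qed.

Lemma word_exists v : exists2 ws, word_of v ws & size ws = ell v.
Proof.
have [k] := ubnP (ell v); elim: k v => // k IH v vk.
have [v0|/eqP] := eqVneq (ell v) 0%N.
  exists [::] => //; exists (exist _ v (ell_eq0 v0) : Omega P).
  by rewrite big_nil mul1g.
(* Descents concern right multiplication, but the factor in Omega must stay at the right end of the
   word; passing to the inverse lets s be removed on the left. *)
rewrite -ell_inv => /eqP/descent_exists[s] /ell_descent.
rewrite -[X in (_ * X)%g]SaV -invgM !ell_inv => sv.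
have [|ws [g vE] wss] := IH (val s * v)%g; first by rewrite -ltnS -sv.
exists (s :: ws); last by rewrite /= wss.
by exists g; rewrite big_cons -mulgA -vE mulgA Sa_invol mul1g.
Qed.

Lemma stabAf1 : stabAf (1%g : extW P).
Proof.
apply/asboolP; rewrite (_ : act 1%g = id) ?image_id //.
by apply/funext => x; exact: act1.
Qed.

Lemma ell1 : ell 1%g = 0%N.
Proof. by have := stabAf1; rewrite invs_stabAf /ell => /eqP ->. Qed.

Lemma ell_prod_leq ws : (ell (\prod_(s <- ws) val s)%g <= size ws)%N.
Proof.
elim/last_ind: ws => [|ws s IH].
  by rewrite big_nil ell1.
rewrite -cats1 big_cat big_seq1 size_cat addn1.
by apply: leq_trans (ell_mul_leq _ _) _.
Qed.

Lemma ell_word v ws : word_of v ws -> (ell v <= size ws)%N.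
Proof. by move=> [[g gA] ->]; rewrite ell_mulOmega // ell_prod_leq. Qed.

Lemma redwP v : reduced_word v (redw v).
Proof.
apply: xgetPex; have [ws vws sws] := word_exists v.
by exists ws; split => // ws' /ell_word; rewrite sws.
Qed.

Lemma reduced_word_size v ws : reduced_word v ws -> size ws = ell v.
Proof.
move=> [vws wmin]; apply/eqP; rewrite eqn_leq ell_word // andbT.
by have [ws' vws' <-] := word_exists v; apply: wmin.
Qed.

Lemma lenE v : len v = ell v.
Proof. exact: reduced_word_size (redwP v). Qed.

End Length.

(** * Simple transitivity on generalized alcoves *)

Section SimplyTransitive.
Variables (R : realType) (P : based_root_datum R).
Local Notation n := (rk P).
Local Notation V := 'cV[R]_n.
Local Notation affine := ('rV[int]_n * int)%type.
Implicit Types (b c : affine) (x y z : V) (u v g : extW P) (s : Sa P).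
Implicit Types (ws : seq (Sa P)).

Definition wprod ws : extW P := (\prod_(s <- ws) val s)%g.

Lemma wprod_nil : wprod [::] = 1%g. Proof. exact: big_nil. Qed.

Lemma wprod_cons s ws : wprod (s :: ws) = (val s * wprod ws)%g.
Proof. exact: big_cons. Qed.

Lemma wprod_cat ws ws' : wprod (ws ++ ws') = (wprod ws * wprod ws')%g.
Proof. exact: big_cat. Qed.

Lemma wprod_rcons ws s : wprod (rcons ws s) = (wprod ws * val s)%g.
Proof. by rewrite -cats1 wprod_cat wprod_cons wprod_nil mulg1. Qed.

(** Pull [simple_root s] back through the letters, starting from the last. The letter [s1] that
    turns it negative must have it as its own simple root, so [s1] is the conjugate of s by the
    remaining suffix, and multiplying by s erases [s1]. *)
Lemma exchange ws s : ~~ ascent (wprod ws) s ->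
  exists2 ws', size ws = (size ws').+1 & wprod ws' = (wprod ws * val s)%g.
Proof.
elim: ws => [|s1 ws IH].
  by rewrite wprod_nil /ascent invg1 aff_act1 simple_root_pos.
have [us|/IH[ws' wss wsE] _] := boolP (ascent (wprod ws) s); last first.
  by exists (s1 :: ws'); rewrite /= ?wss // !wprod_cons wsE mulgA.
rewrite wprod_cons /ascent invgM SaV aff_actM => s1us.
exists ws => //; have ra := simple_root_root s.
have : val s1 = arefl (aff_act (simple_root s) (wprod ws)^-1%g).
  by rewrite (simple_root_unique _ us s1us) ?aff_act_root // val_SaE.
rewrite arefl_conj // invgK -val_SaE => ->.
by rewrite -!mulgA [((wprod ws)^-1 * _)%g]mulgA mulVg mul1g Sa_invol mulg1.
Qed.

Lemma deletion ws : (ell (wprod ws) < size ws)%N ->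
  exists2 ws', (size ws' < size ws)%N & wprod ws' = wprod ws.
Proof.
elim/last_ind: ws => // ws s IH; rewrite wprod_rcons size_rcons.
have [lt_ws _|le_ws] := ltnP (ell (wprod ws)) (size ws).
  have [ws' lt_ws' wsE] := IH lt_ws.
  by exists (rcons ws' s); rewrite ?size_rcons ?ltnS // wprod_rcons wsE.
have [us|us _] := boolP (ascent (wprod ws) s).
  by rewrite ell_ascent // ltnS ltnNge le_ws.
have [ws' wss <-] := exchange us.
by exists ws'; rewrite // wss ltnW // ltnS.
Qed.

Lemma wprod_ell0 ws : ell (wprod ws) = 0%N -> wprod ws = 1%g.
Proof.
have [k] := ubnP (size ws); elim: k ws => // k IH ws wsk ws0.
have [/size0nil ->|ws_gt0] := posnP (size ws); first exact: wprod_nil.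
have [|ws' lt_ws wsE] := @deletion ws; first by rewrite ws0.
by rewrite -wsE IH // ?wsE //; apply: leq_trans lt_ws _.
Qed.

(* A shortest reflection conjugate to [arefl b] under the group generated by the
   simple reflections is itself simple. *)
Lemma arefl_wprod b : b.1 \in roots P -> exists ws, arefl b = wprod ws.
Proof.
have [k] := ubnP (ell (arefl b)); elim: k b => // k IH b bk rb.
have /descent_exists[s rs] : ell (arefl b) != 0%N.
  have r0 c : c.1 \in roots P -> aff_pos c -> ell (arefl c) != 0%N.
    move=> rc c0; rewrite -lt0n -has_predT; apply/hasP; exists c => //.
    by rewrite mem_invs rc c0 aff_act_arefl // aff_posN // c0.
  have [|nb] := boolP (aff_pos b); first exact: r0.
  by rewrite -arefl_opp // r0 ?aff_rootN ?aff_posN.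
have ra := simple_root_root s.
have rE : arefl (aff_act b (val s)) = (val s * arefl b * val s)%g.
  by rewrite arefl_conj // SaV.
have [srs|srs] := boolP (ascent (val s * arefl b)%g s); last first.
  have [||ws wsE] := IH (aff_act b (val s)); rewrite ?aff_act_root //.
    have E1 := ell_descent rs; have := ell_descent srs; rewrite -rE.
    rewrite -[ell (val s * _)%g]ell_inv invgM SaV arefl_inv // => E2.
    by move: bk; rewrite E1 E2; lia.
  exists (s :: rcons ws s); rewrite wprod_cons wprod_rcons -wsE rE.
  by rewrite -!mulgA Sa_invol mulg1 mulgA Sa_invol mul1g.
move: rs srs; rewrite /ascent invgM SaV arefl_inv // aff_actM => rs srs.
(* Conjugation by s fails to shorten. The image of [simple_root s] under the reflection is negative
   and s makes it positive, so it can only be minus [simple_root s]. *)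
have aE : aff_act (simple_root s) (arefl b) = - simple_root s.
  apply: oppr_inj; rewrite opprK; apply: simple_root_unique.
  - by rewrite aff_rootN aff_act_root.
  - by rewrite aff_posN ?aff_act_root.
  - by rewrite aff_actN aff_posN ?negbK ?aff_act_root.
exists [:: s]; rewrite wprod_cons wprod_nil mulg1 val_SaE.
suff [->//|->] : b = simple_root s \/ b = - simple_root s by rewrite arefl_opp.
case: (simple_root s) b ra rb aE {k IH bk rE rs srs} => [a j] [c m] /= ra rc.
rewrite /aff_act lin_arefl //= mulmx_srefl pairingZr => -[aE jE].
have {}aE : 2 *: a = pairing a (coroot c) *: c.
  by move/eqP: aE; rewrite subr_eq addrC -subr_eq opprK => /eqP <-;
    rewrite scaler_nat.
have [cE|cE] := root_reduced ra rc (isT : 2 != 0 :> int) aE; [left|right];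
  rewrite cE in jE *.
  suff -> : m = j by [].
  by move: jE; rewrite root_coroot //; lia.
suff -> : m = - j by [].
by move: jE; rewrite coroot_opp // pairingNr root_coroot //; lia.
Qed.

Lemma weyl_wprod (w : weyl P) : exists ws, ExtW w 0 = wprod ws.
Proof.
have /asboolP[r] := weylP w; elim: r w => [|a r IH] w rP wE.
  exists [::]; rewrite wprod_nil; apply: extW_eq => //=.
  by rewrite wE big_nil.
have ra : a \in roots P by apply: rP; rewrite mem_head.
have rP' : {subset r <= roots P} by move=> c cr; apply: rP; rewrite inE cr orbT.
have rW : \prod_(c <- r) srefl c \in @weyl_pred P by apply/asboolP; exists r.
have [ws wsE] := IH (Weyl rW) rP' erefl.
have [ws' wsE'] := @arefl_wprod (a, 0) ra.
exists (ws' ++ ws); rewrite wprod_cat -wsE -wsE'; apply: extW_eq => /=.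
  rewrite wE big_cons insubdK //; exact: weyl_srefl.
by rewrite oppr0 scale0r mulmx0 addr0.
Qed.

(** Length 0 alone only means membership in Omega. It forces the identity here because w is a
    product of simple reflections and deletion shortens its word to the empty one. *)
Lemma weyl_stabAf (w : weyl P) : stabAf (ExtW w 0) -> ExtW w 0 = 1%g.
Proof.
have [ws ->] := weyl_wprod w; rewrite invs_stabAf => /eqP w0.
by apply: wprod_ell0; rewrite /ell w0.
Qed.

(** The quotient of two elements with the same generalized alcove stabilizes A_f and has no
    translation part, so it is an element of W in Omega. *)
Lemma alc_inj : injective (@alc R P).
Proof.
move=> u v [uvA uvt]; have g0 : trans (u^-1 * v)%g = 0.
  by rewrite /= uvt addNr.
have gE : (u^-1 * v)%g = ExtW (lin (u^-1 * v)%g) 0.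
  by apply: extW_eq; rewrite ?g0.
have : stabAf (u^-1 * v)%g.
  apply/asboolP; rewrite act_image_mul -uvA -act_image_mul mulVg.
  exact/asboolP/stabAf1.
by rewrite gE => /weyl_stabAf; rewrite -gE => /mulg1_eq; rewrite invgK.
Qed.

Lemma alcK v : elt (alc v) = v.
Proof. by apply: xget_unique => // u /alc_inj. Qed.

End SimplyTransitive.

(** * Alcoves as cells of the affine roots: transitivity and the order relation *)

Section Cells.
Variables (R : realType) (P : based_root_datum R).
Local Notation n := (rk P).
Local Notation V := 'cV[R]_n.
Local Notation affine := ('rV[int]_n * int)%type.
Implicit Types (b c : affine) (x y z : V) (u v g : extW P) (s : Sa P).

(** The floor box restated by signs of affine roots; unlike floors, these are visibly transported by
    the group. *)
Definition cell x : set V :=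
  [set y | forall c, c.1 \in roots P -> 0 < aff_eval c x -> 0 <= aff_eval c y].

Lemma regular_aff_neq0 x c : regular x -> c.1 \in roots P -> aff_eval c x != 0.
Proof.
case: c => a m rx /= ra; rewrite /aff_eval /= addr_eq0 -intrN; apply/eqP.
have [ap|ap] := boolP (a \in pos P); first exact: rx.
have nap : - a \in pos P by rewrite pos_opp.
by have := rx (- a) m nap; rewrite evalVNl => xm /(congr1 -%R);
  rewrite intrN opprK.
Qed.

Lemma regular_act v x : regular x -> regular (act v x).
Proof.
move=> rx a m ap vx; have := @regular_aff_neq0 x (aff_act (a, - m) v) rx.
rewrite aff_act_root aff_eval_act /aff_eval /= vx intrN subrr eqxx.
by rewrite pos_root // => /(_ isT).
Qed.

Lemma cell_box x : regular x ->
  [set y | forall a, a \in pos P -> (Num.floor (evalV a x))%:~R <= evalV a y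
                                <= (Num.floor (evalV a x))%:~R + 1] = cell x.
Proof.
move=> rx; apply/seteqP; split => y /= yx.
  case=> a m /= ra; rewrite /aff_eval /=; have [ap|ap] := boolP (a \in pos P).
    rewrite -ltrBlDr sub0r -intrN => /ltW; rewrite -floor_ge_int => fm.
    have /andP[fy _] := yx a ap; rewrite -lerBlDr sub0r -intrN.
    by apply: le_trans fy; rewrite ler_int.
  have nap : - a \in pos P by rewrite pos_opp.
  have /andP[_ fy] := yx _ nap;
    rewrite -[evalV a x]opprK -evalVNl addrC subr_gt0.
  rewrite -floor_lt_int => fm;
    rewrite -[evalV a y]opprK -evalVNl addrC subr_ge0.
  by apply: le_trans fy _; rewrite -[X in _ + X]/(1%:~R) -intrD ler_int lezD1.
move=> a ap; have /andP[f1 f2] := floor_regular rx ap; have ra := pos_root ap.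
have := yx (a, - Num.floor (evalV a x));
  have := yx (- a, Num.floor (evalV a x) + 1).
rewrite /aff_eval /= !evalVNl root_oppE ra intrN intrD subr_gt0 f1 subr_ge0.
rewrite addrC subr_gt0 f2 => /(_ isT isT);
  rewrite addrC subr_ge0 => -> /(_ isT isT) ->.
by [].
Qed.

Lemma alcoveE A : @alcove R P A <-> exists2 x, regular x & A = cell x.
Proof.
have UE x : (~` [set y : V | exists a m, a \in pos P /\
  hyp a m y]) x <-> regular x.
  split => [Ux a m ap xm|rx [a [m [ap xm]]]]; first by apply: Ux; exists a, m.
  exact: rx xm.
split=> -[x rx ->]; exists x; rewrite ?alcove_closureE ?cell_box //; exact/UE.
Qed.

Lemma aff_pos_eval x c : regular x -> Af x -> c.1 \in roots P ->
  (0 < aff_eval c x) = aff_pos c.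
Proof.
move=> rx Ax rc; have cx := regular_aff_neq0 rx rc.
have [c0|c0] := boolP (aff_pos c).
  by rewrite lt_neqAle eq_sym cx aff_eval_ge0.
apply/negbTE; rewrite -leNgt -oppr_ge0 -aff_evalN.
by apply: aff_eval_ge0; rewrite ?aff_rootN ?aff_posN.
Qed.

Lemma act_Af_cell v x : regular x -> Af x -> act v @` @Af R P = cell (act v x).
Proof.
move=> rx Ax; apply/seteqP; split => [_ [z Az <-] c rc|y yv].
  rewrite -!aff_eval_act aff_pos_eval ?aff_act_root // => cv.
  by apply: aff_eval_ge0; rewrite ?aff_act_root.
exists (act v^-1%g y); last by rewrite actKV.
apply/Af_aff_posP => b rb b0; rewrite -aff_eval_act; apply: yv.
  by rewrite aff_act_root.
by rewrite -aff_eval_act aff_actKV aff_pos_eval.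
Qed.

Lemma x0_regular : @regular R P x0.
Proof.
move=> a m ap xm; have := x0P ap; rewrite xm ltr0z ltrz1.
by lia.
Qed.

Lemma Af_inV0 : Af (inV 0 : V).
Proof. by move=> a ap; rewrite evalV_inV pairing0r lexx ler01. Qed.

Lemma alc_galcoves v : galcoves P (alc v).
Proof.
split; first apply/alcoveE.
  exists (act v x0); first exact/regular_act/x0_regular.
  exact: act_Af_cell x0_regular x0_Af.
exists (inV 0); first exact: Af_inV0.
by rewrite /act /inV map_mx0 mulmx0 add0r.
Qed.

(* A wall of A_f that separates it from a point of the open unit box around 0
   passes through 0, so that point is moved into A_f by linear reflections. *)
Lemma chamber_exists z : regular z ->
  (forall a, a \in pos P -> -1 < evalV a z < 1) ->
  exists w : weyl P, Af (act (ExtW w 0) z).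
Proof.
pose N y := [seq a <- undup (pos P) | evalV a y < 0].
have [k] := ubnP (size (N z)); elim: k z => // k IH z zk rz z1.
have z1r a : a \in roots P -> -1 < evalV a z < 1.
  move=> ra; have [/z1 //|ap] := boolP (a \in pos P).
  have := z1 (- a); rewrite pos_opp // evalVNl => /(_ ap) /andP[? ?].
  by apply/andP; split; lra.
have [Az|/outside_Af[s sz]] := pselect (Af z).
  by exists 1%g; rewrite (_ : ExtW _ 0 = 1%g) // act1.
have ra := simple_root_root s; have a0 := simple_root_pos s.
have sE := val_SaE s; have := @simple_root_unique _ _ s.
case: (simple_root s) ra a0 sE sz => a m ra a0 sE sz uniq_s; rewrite /= in ra.
have /andP[za1 za2] := z1r a ra.
have m0 : m = 0.
  move: a0 sz; rewrite /aff_pos /aff_eval /=;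
    case: (boolP (a \in pos P)) => /= ap m0.
    move=> am; have : (m%:~R : R) < 1 by lra.
    by rewrite ltrz1; lia.
  move=> am; have : 1 <= m%:~R :> R by rewrite ler1z.
  by move=> m1; exfalso; move: m1 am za1; clear; lra.
rewrite {m}m0 in a0 sE sz uniq_s; rewrite /aff_eval /= addr0 in sz.
have ap : a \in pos P by move: a0; rewrite /aff_pos /=; case: (a \in _).
have evs (e : 'rV[int]_n) : evalV e (act (val s) z) = evalV (e *m srefl a) z.
  by rewrite evalV_act sE lin_arefl //= oppr0 scale0r pairing0r addr0.
have [||e ep|w wA] := IH (act (val s) z).
- rewrite -ltnS; apply: leq_ltn_trans zk.
  (* [srefl a] injects the positive roots negative at s z into those negative at z, and misses a
     itself; so the count drops. *)
  have -> : (size (N (act (val s) z))).+1 =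
      size (a :: map (mulmx^~ (srefl a)) (N (act (val s) z))) by rewrite /=
        size_map.
  have inj : injective (mulmx^~ (srefl a) : 'rV[int]_n -> _).
    by move=> e f /(congr1 (mulmx^~ (srefl a)));
      rewrite -!mulmxA srefl_sq // !mulmx1.
  apply: uniq_leq_size.
    rewrite /= (map_inj_uniq inj) filter_uniq ?undup_uniq // andbT.
    apply/negP => /mapP[e + ae]; rewrite mem_filter mem_undup => /andP[_].
    move: ae => /(congr1 (mulmx^~ (srefl a)));
      rewrite /= -mulmxA srefl_sq // mulmx1.
    by rewrite root_srefl_self // => <-; rewrite pos_opp // ap.
  move=> f; rewrite inE mem_filter mem_undup => /orP[/eqP -> |/mapP[e]].
    by rewrite sz ap.
  rewrite mem_filter mem_undup evs => /andP[ez ep] ->; rewrite ez /=.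
  apply: contraT => es; have /(congr1 fst) /= eE : (e, 0) = (a, 0) :> _ * int.
    apply: uniq_s; rewrite /aff_pos /= ?ep ?pos_root //.
    by rewrite sE /aff_act lin_arefl //= es oppr0 scale0r pairing0r addr0.
  by move: ez; rewrite eE root_srefl_self // evalVNl oppr_lt0 ltNge ltW.
- exact: regular_act.
- by rewrite evs; apply: z1r; apply: root_refl => //; apply: pos_root.
exists (w * lin (val s))%g;
  rewrite (_ : ExtW _ 0 = ExtW w 0 * val s)%g ?act_mul //.
by rewrite sE; apply: extW_eq => //=; rewrite oppr0 scale0r mulmx0 addr0.
Qed.

(** After translating mu to the origin, 0 lies in the closed alcove, so each positive root takes
    values in (-1, 1) at its regular point. This is the box required by [chamber_exists]. *)
Lemma galcoves_alc A : galcoves P A -> exists v, A = alc v.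
Proof.
case: A => A mu [/= /alcoveE[x rx ->] muA].
have rx' : regular (x - inV mu).
  have -> : x - inV mu = act (tau (- mu)) x.
    by rewrite /act /= map_mx1 mul1mx /inV map_mxN.
  exact: regular_act.
have [a ap|w wA] := chamber_exists rx'.
  have /andP[f1 f2] := floor_regular rx ap.
  move: muA; rewrite -cell_box // => /(_ a ap) /andP[m1 m2].
  by rewrite evalVB; apply/andP; split; lra.
pose v : extW P := (tau mu * (ExtW w 0)^-1)%g.
have xE : x = act v (act (ExtW w 0) (x - inV mu)).
  by rewrite act_mul actK /act /= map_mx1 mul1mx subrK.
exists v; congr (_, _).
  by rewrite [in LHS]xE (act_Af_cell _ _ wA) //; apply: regular_act.
by rewrite /= mulmx0 oppr0 mulmx0 addr0.
Qed.

Lemma ract_alc u v : ract (alc u) v = alc (u * v)%g.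
Proof. by rewrite /ract alcK. Qed.

(** The affine root c of the common wall is nonnegative on the alcove of v; lying on the lower side
    of that wall means that c has the form m - a with a a positive root. Any hyperplane witnessing
    [prec] contains the common facet, so [affine_root_facet] identifies it with this wall. *)
Lemma prec_alc v s :
  prec (alc v) s <-> (aff_act (simple_root s) v^-1%g).1 \notin pos P.
Proof.
set c := aff_act _ _;
  have rc : c.1 \in roots P by rewrite aff_act_root simple_root_root.
have cv x : aff_eval c (act v x) = aff_eval (simple_root s) x.
  by rewrite -aff_eval_act aff_actKV.
have ge0 x : Af x -> 0 <= aff_eval (simple_root s) x.
  by apply: aff_eval_ge0; [exact: simple_root_root|exact: simple_root_pos].
split.
  move=> [a [m [ap]]]; rewrite ract_alc /= => inter side.
  have ra := pos_root ap; have [_ _ _ [p sp pA]] := simple_rootP s.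
  have Hp y : aff_eval (simple_root s) y = 0 -> Af y ->
    evalV a (act v y) = m%:~R.
    move=> sy Ay; apply: inter; split; first by exists y.
    by exists y => //; rewrite act_mul act_facet.
  have vE y : aff_eval (aff_act (a, - m) v) y = evalV a (act v y) - m%:~R.
    by rewrite aff_eval_act /aff_eval intrN.
  have av : (aff_act (a, - m) v).1 \in roots P by rewrite aff_act_root.
  have Ap : Af p by exact: nbhs_singleton pA _.
  have vp : aff_eval (aff_act (a, - m) v) p = 0 by rewrite vE Hp ?subrr.
  have near0 : \forall y \near p, aff_eval (simple_root s) y = 0 ->
      0 <= aff_eval (aff_act (a, - m) v) y.
    by apply: filterS pA => y yA sy; rewrite vE Hp ?subrr //; apply: yA.
  have [E|E] := affine_root_facet (simple_root_root s) av sp vp near0.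
    have : 0 < aff_eval (simple_root s) x0.
      by rewrite aff_eval_x0 ?simple_root_pos // simple_root_root.
    rewrite -E vE subr_gt0 ltNge => /negP[]; apply: side.
    by exists x0 => //; exact: x0_Af.
  have cE : c = - (a, - m) by rewrite -[LHS]opprK -aff_actN -E aff_actK.
  by have := pos_opp ra; rewrite -[- a]/((- (a, - m)).1) -cE ap => ->.
case: c rc cv => a m /= ra cv ap; exists (- a), m; split;
  first by rewrite pos_opp.
  rewrite ract_alc /= => _ [[x Ax <-] [y Ay]];
    rewrite act_mul /hyp /= evalVNl => yx.
  have := ge0 x Ax; rewrite -cv -yx cv -aff_eval_act simple_root_act aff_evalN
    => le0.
  have := ge0 y Ay => ge0y; have xE : aff_eval (simple_root s) y = 0 by lra.
  have := cv (act (val s) y);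
    rewrite -[RHS]aff_eval_act simple_root_act aff_evalN.
  by rewrite xE oppr0 yx /aff_eval /= => /eqP;
    rewrite addrC addr_eq0 => /eqP ->.
move=> _ [x Ax <-] /=; have := ge0 x Ax; rewrite -cv /aff_eval /= evalVNl.
by rewrite addrC -[X in _ + X]opprK subr_ge0.
Qed.

End Cells.

(** * Weights and translations *)

Lemma qhalf_unit : qhalf \is a GRing.unit.
Proof.
have X1 : (tofrac 'X)^-1 \in laurent_pred.
  by apply/asboolP; exists 1, 1%N; rewrite rmorph1 div1r expr1.
by apply/unitrP; exists (Laurent X1); split; apply: val_inj => /=;
  rewrite ?mulVf ?divff // tofracX_neq0.
Qed.

Section Weights.
Variables (R : realType) (P : based_root_datum R) (d : Sa P -> nat).
Hypothesis hd : conj_invariant d.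
Local Notation n := (rk P).
Local Notation affine := ('rV[int]_n * int)%type.
Implicit Types (b c : affine) (u v g : extW P) (s : Sa P) (w : weyl P).
Implicit Types (ws : seq (Sa P)) (l mu : 'cV[int]_n).

(* Extends [d], read as a function on the simple affine roots, along the action
   of the extended affine Weyl group. *)
Definition aff_weight b : nat :=
  xget 0%N [set k | exists s u, b = aff_act (simple_root s) u /\ k = d s].

Lemma aff_weight_act b u : aff_weight (aff_act b u) = aff_weight b.
Proof.
congr xget; apply/seteqP; split => k [s [u' [bE ->]]]; exists s.
  by exists (u' * u^-1)%g; rewrite aff_actM -bE aff_actK.
by exists (u' * u)%g; rewrite aff_actM -bE.
Qed.

Lemma aff_weightN b : aff_weight (- b) = aff_weight b.
Proof.
congr xget; apply/seteqP; split => k [s [u [bE ->]]]; exists s, (val s * u)%g.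
  by rewrite aff_actM simple_root_act aff_actN -bE opprK.
by rewrite aff_actM simple_root_act aff_actN -bE.
Qed.

(** Simple affine roots in one orbit have conjugate reflections, so invariance of d makes the
    extension well defined. *)
Lemma aff_weight_simple s : aff_weight (simple_root s) = d s.
Proof.
apply: xget_unique; first by exists s, 1%g; rewrite aff_act1.
move=> k [s' [u [sE ->]]]; apply: (@hd _ _ u^-1%g).
by rewrite invgK !val_SaE sE arefl_conj // simple_root_root.
Qed.

(** The exponent of q in q_v, expressed without the reduced word chosen by [redw]. *)
Definition weight v : nat := (\sum_(b <- invs v) aff_weight b)%N.

Lemma weight_mul u v : (forall b, b \in invs u ->
  ~~ aff_pos (aff_act b (u * v)%g)) ->
  weight (u * v)%g = (weight u + weight v)%N.
Proof.
move=> /invs_mul uv; rewrite /weight (perm_big _ uv) big_cat big_map.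
by congr addn; apply: eq_bigr => b _; rewrite aff_weight_act.
Qed.

Lemma weight_inv v : weight v^-1%g = weight v.
Proof.
rewrite /weight (perm_big _ (invs_inv v)) big_map.
by apply: eq_bigr => b _; rewrite aff_weightN aff_weight_act.
Qed.

Lemma weight_mulOmega u g : stabAf g -> weight (u * g)%g = weight u.
Proof. by move=> gA; rewrite /weight (perm_big _ (invs_mulOmega u gA)). Qed.

Lemma weight_ascent u s : ascent u s ->
  weight (u * val s)%g = (weight u + d s)%N.
Proof.
move=> us; rewrite /weight (perm_big _ (invs_ascent us)) -cats1 big_cat
  big_seq1.
by rewrite aff_weight_act aff_weight_simple.
Qed.

Lemma weight_wprod ws : ell (wprod ws) = size ws ->
  weight (wprod ws) = (\sum_(s <- ws) d s)%N.
Proof.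
elim/last_ind: ws => [|ws s IH].
  have := stabAf1 P; rewrite wprod_nil invs_stabAf => /eqP E _.
  by rewrite /weight E !big_nil.
rewrite wprod_rcons size_rcons => ell_wss.
have us : ascent (wprod ws) s.
  apply: contraT => /ell_descent; rewrite ell_wss => ell_ws.
  by have := ell_prod_leq ws; rewrite -/(wprod ws) ell_ws ltnNge leqnSn.
rewrite weight_ascent // IH -?cats1 ?big_cat ?big_seq1 //.
by move: ell_wss; rewrite ell_ascent // => -[].
Qed.

Lemma weight_redw v : weight v = (\sum_(s <- redw v) d s)%N.
Proof.
have vr := redwP v; have [[[g gA] vE] _] := vr.
have := reduced_word_size vr; rewrite {2 3}vE /= -/(wprod _).
by rewrite ell_mulOmega // weight_mulOmega // => /esym/weight_wprod.
Qed.

Lemma qwE v : qw d v = qhalf ^+ (2 * weight v).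
Proof.
rewrite exprM weight_redw expr_sum; exact: eq_bigr.
Qed.

Lemma qw_halfE v : qw_half d v = qhalf ^+ weight v.
Proof. by rewrite weight_redw expr_sum. Qed.

Lemma tau_mul l mu : (tau l * tau mu)%g = tau (l + mu) :> extW P.
Proof. by apply: extW_eq; rewrite /= ?mulmx1 // mul1mx. Qed.

Lemma dominant_neg l (a : 'rV[int]_n) : @dominant R P l ->
  a \in roots P -> a \notin pos P -> pairing a l <= 0.
Proof.
by move=> ldom ra ap; rewrite -oppr_ge0 -pairingNl; apply: ldom;
  rewrite pos_opp.
Qed.

Lemma aff_act_tau b l : aff_act b (tau l) = (b.1, b.2 + pairing b.1 l).
Proof. by rewrite /aff_act /= mulmx1. Qed.

Lemma invs_tau_mul l mu b : @dominant R P l -> @dominant R P mu ->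
  b \in invs (tau l) -> ~~ aff_pos (aff_act b (tau l * tau mu)%g).
Proof.
move=> ldom mudom; rewrite mem_invs tau_mul !aff_act_tau.
case: b => a m; rewrite /aff_pos /= -!ltNge pairingDr => /and3P[ra].
have [ap|ap] := boolP (a \in pos P) => /= m0.
  by have := ldom a ap; lia.
by have := dominant_neg mudom ra ap; lia.
Qed.

Lemma ell_tauD l mu : @dominant R P l -> @dominant R P mu ->
  ell (tau (l + mu) : extW P) = (ell (tau l : extW P) + ell (tau mu : extW
    P))%N.
Proof.
by move=> ldom mudom; rewrite -tau_mul ell_mul // => b; apply: invs_tau_mul.
Qed.

Lemma weight_tauD l mu : @dominant R P l -> @dominant R P mu ->
  weight (tau (l + mu)) = (weight (tau l) + weight (tau mu))%N.
Proof.
by move=> ldom mudom; rewrite -tau_mul weight_mul // => b; apply: invs_tau_mul.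
Qed.

Definition strictly_dominant l := forall a, a \in pos P -> 1 <= pairing a l.

Lemma strictly_dominantW l : strictly_dominant l -> @dominant R P l.
Proof. by move=> ldom a /ldom; apply: le_trans. Qed.

(** For a positive root, strictness raises the constant to at least 1, which is positive whatever w
    does to the linear part. So inversions have a negative linear part and a translated constant at
    most 0, which stays negative once w is removed. *)
Lemma invs_tau_weyl l w b : strictly_dominant l ->
  b \in invs (tau l * ExtW w 0)%g ->
  ~~ aff_pos (aff_act b (tau l * ExtW w 0 * (ExtW w 0)^-1)%g).
Proof.
move=> ldom; rewrite mulgK mem_invs aff_act_tau aff_actM aff_act_tau.
case: b => a m; rewrite /aff_pos /aff_act /= -!ltNge pairing0r addr0.
move=> /and3P[ra].
have [ap|ap] /= := boolP (a \in pos P).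
  by have := ldom a ap; case: (_ \notin _); lia.
by case: (_ \notin _); lia.
Qed.

Lemma deep_coweight2 (mu nu : 'cV[int]_n) (N : int) : exists l,
  [/\ strictly_dominant l, strictly_dominant (l + mu), strictly_dominant (l +
    nu) &
      forall a, a \in pos P -> N <= pairing a l].
Proof.
have [M M0 Mmu] := seq_bounded (pos P) (fun a => - pairing a mu : int).
have [M' M'0 Mnu] := seq_bounded (pos P) (fun a => - pairing a nu : int).
have [l lP] := deep_coweight P (`|N| + M + M' + 1).
exists l; split => a ap; rewrite ?pairingDr; have := lP a ap;
  have := Mmu a ap; have := Mnu a ap; lia.
Qed.

Definition weyl_part v : extW P := ExtW (lin v) 0.

Lemma tau_weyl_part v : (tau (trans v) * weyl_part v)%g = v.
Proof. by apply: extW_eq; rewrite /= mul1mx // addr0. Qed.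

Lemma tau_mul_split l v : (tau l * v)%g = (tau (l + trans v) * weyl_part v)%g.
Proof. by rewrite -tau_mul -mulgA tau_weyl_part. Qed.

Lemma ell_tau_weyl l v : strictly_dominant (l + trans v) ->
  ell (tau (l + trans v) : extW P) =
  (ell (tau l * v)%g + ell (weyl_part v)^-1%g)%N.
Proof.
move=> ldom; rewrite tau_mul_split.
by rewrite -(ell_mul (fun b => @invs_tau_weyl _ (lin v) b ldom)) mulgK.
Qed.

Lemma weight_tau_weyl l v : strictly_dominant (l + trans v) ->
  weight (tau (l + trans v)) = (weight (tau l * v)%g + weight (weyl_part v))%N.
Proof.
move=> ldom; rewrite tau_mul_split -[weight (weyl_part v)]weight_inv.
by rewrite -(weight_mul (fun b => @invs_tau_weyl _ (lin v) b ldom)) mulgK.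
Qed.

Lemma qXE l l' : @dominant R P l -> @dominant R P l' ->
  qX d (l - l') = qhalf ^+ weight (tau l) / qhalf ^+ weight (tau l').
Proof.
move=> ldom ldom'; apply: xget_unique.
  by exists l, l'; rewrite !qw_halfE.
move=> c [k [k' [kdom kdom' lk ->]]]; rewrite !qw_halfE.
have kl : k + l' = l + k'.
  by apply/eqP; rewrite -subr_eq -addrA [l' - _]addrC addrA -lk subrK.
apply/eqP.
have U m : qhalf ^+ m \is a GRing.unit by rewrite unitrX // qhalf_unit.
rewrite -(inj_eq (mulIr (U (weight (tau l'))))) divrK //.
rewrite -(inj_eq (mulIr (U (weight (tau k'))))) mulrAC divrK // -!exprD.
by rewrite -!weight_tauD // kl.
Qed.

End Weights.

(** * The Hecke algebra *)

(** The scalar of X_(A_v): x, y and z are the square roots of q for tau_l, tau_l v and delta(A_v).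
    Only squares survive. *)
Lemma square_ratio (A : comUnitRingType) (x y z : A) :
  x \is a GRing.unit -> y \is a GRing.unit -> z \is a GRing.unit ->
  x / (y * z) * z ^+ 2 * (y * z / x)^-1 = x ^+ 2 / y ^+ 2.
Proof.
move=> Ux Uy Uz; rewrite !expr2 !invrM ?unitrM ?unitrV ?Uy ?Uz ?Ux // invrK.
have -> : x * (z^-1 * y^-1) * (z * z) * (x * (z^-1 * y^-1)) =
    (x * x * (y^-1 * y^-1)) * (z * z^-1) * (z * z^-1) by ring.
by rewrite divrr // !mulr1.
Qed.

Section Hecke.
Variables (R : realType) (P : based_root_datum R) (d : Sa P -> nat).
Hypothesis hd : conj_invariant d.
Variables (H : unitAlgType laurent) (T : extW P -> H).
Hypothesis hT : hecke_algebra d T.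
Local Notation n := (rk P).
Implicit Types (u v g : extW P) (s : Sa P) (l mu : 'cV[int]_n).

Lemma hecke_mul_ell u v : ell (u * v)%g = (ell u + ell v)%N ->
  T u * T v = T (u * v)%g.
Proof. by rewrite -!lenE; apply: hecke_mul hT _ _. Qed.

(** Expand 1 in the basis: [T 1%g] fixes each basis element from the left, hence fixes 1. *)
Lemma hecke1 : T 1%g = 1.
Proof.
have [r [c cE]] := hecke_span hT 1.
rewrite -[LHS]mulr1 cE mulr_sumr; apply: eq_bigr => w _.
by rewrite -scalerAr hecke_mul_ell mul1g ?ell1.
Qed.

Lemma qs_unit s : qs d s \is a GRing.unit.
Proof. by rewrite !unitrX // qhalf_unit. Qed.

Lemma hecke_quadE s : T (val s) * T (val s) = (qs d s)%:A + (qs d s - 1) *: T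
  (val s).
Proof. by rewrite -expr2 (hecke_quad hT) hecke1. Qed.

Lemma hecke_simple_unit s : T (val s) \is a GRing.unit.
Proof.
have q1 := qs_unit s; pose q := qs d s.
have TT : T (val s) * (T (val s) - (q - 1)%:A) = q%:A.
  by rewrite mulrBr hecke_quadE -scalerAr mulr1 addrK.
have TT' : (T (val s) - (q - 1)%:A) * T (val s) = q%:A.
  by rewrite mulrBl hecke_quadE -scalerAl mul1r addrK.
apply/unitrP; exists (q^-1 *: (T (val s) - (q - 1)%:A)).
by rewrite -scalerAl -scalerAr TT TT' scalerA mulVr // scale1r.
Qed.

Lemma hecke_mulOmega u g : stabAf g -> T u * T g = T (u * g)%g.
Proof.
move=> gA; apply: hecke_mul_ell; rewrite ell_mulOmega //.
by rewrite -[g]mul1g ell_mulOmega // ell1 addn0.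
Qed.

Lemma hecke_ascent u s : ascent u s -> T u * T (val s) = T (u * val s)%g.
Proof.
by move=> us; apply: hecke_mul_ell;
  rewrite ell_ascent // [ell (val s)]/ell invs_simple addn1.
Qed.

Lemma stabAfV g : stabAf g -> stabAf g^-1%g.
Proof.
by rewrite !invs_stabAf => /eqP g0; apply/eqP/size0nil;
  rewrite -/(ell _) ell_inv /ell g0.
Qed.

Lemma hecke_unit v : T v \is a GRing.unit.
Proof.
have [k] := ubnP (ell v); elim: k v => // k IH v vk.
have [v0|/descent_exists[s vs]] := eqVneq (ell v) 0%N.
  have vA := ell_eq0 v0; apply/unitrP; exists (T v^-1%g).
  by rewrite !hecke_mulOmega ?stabAfV // mulVg mulgV hecke1.
have vE := ell_descent vs; rewrite -[v]mulg1 -(Sa_invol s) mulgA.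
rewrite -hecke_ascent ?ascent_mul // unitrMl ?hecke_simple_unit //.
by apply: IH; rewrite -ltnS -vE.
Qed.

Lemma hecke_tauD l mu : @dominant R P l -> @dominant R P mu ->
  T (tau l) * T (tau mu) = T (tau (l + mu)).
Proof. by move=> ldom mudom; rewrite hecke_mul_ell tau_mul ?ell_tauD. Qed.

Lemma hecke_tau_comm l mu : @dominant R P l -> @dominant R P mu ->
  GRing.comm (T (tau l)) (T (tau mu)).
Proof. by move=> ldom mudom; rewrite /GRing.comm !hecke_tauD // addrC. Qed.

Lemma XXE l l' : @dominant R P l -> @dominant R P l' ->
  XX d T (l - l') = (qX d (l - l'))^-1 *: (T (tau l) * (T (tau l'))^-1).
Proof.
move=> ldom ldom'; apply: xget_unique; first by exists l, l'.
move=> x [k [k' [kdom kdom' lk ->]]]; congr (_ *: _).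
have kl : k + l' = l + k'.
  by apply/eqP; rewrite -subr_eq -addrA [l' - _]addrC addrA -lk subrK.
apply: (mulIr (hecke_unit (tau k'))); rewrite divrK ?hecke_unit //.
apply: (mulIr (hecke_unit (tau l'))).
rewrite hecke_tauD // kl -hecke_tauD // -!mulrA; congr (_ * _).
rewrite [T (tau k') * T (tau l')]hecke_tau_comm // mulKr //; exact: hecke_unit.
Qed.

(* T_(tau_l) X_(A_v) = q_(tau_l) X_(A_(tau_l v)), and X_(A_u) = q_u^-1 T_u when
   u A_f is deep in the dominant chamber. *)
Lemma XA_alc v l : @strictly_dominant R P l ->
  @strictly_dominant R P (l + trans v) ->
  XA d T (alc v) = (qhalf ^+ (2 * weight d (tau l)) /
      qhalf ^+ (2 * weight d (tau l * v)%g)) *: ((T (tau l))^-1 * T (tau l *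
        v)%g).
Proof.
move=> lsdom lvsdom; have ldom := strictly_dominantW lsdom.
have lvdom := strictly_dominantW lvsdom.
have U m : qhalf ^+ m \is a GRing.unit by rewrite unitrX // qhalf_unit.
rewrite /XA /wt /delta alcK -/(weyl_part v) /Tbar qwE //.
set k := l + trans v in lvsdom lvdom *.
have -> : - trans v = l - k by rewrite opprD addrA subrr sub0r.
have -> : trans v = k - l by rewrite /k addrC addKr.
rewrite XXE // !qXE // /k weight_tau_weyl // exprD.
rewrite -scalerAl scalerA; congr (_ *: _); last first.
  have lE : T (tau (l + trans v)) = T (tau l * v)%g * T (weyl_part v)^-1%g.
    rewrite hecke_mul_ell; first by rewrite tau_mul_split mulgK.
    by rewrite {1}tau_mul_split mulgK ell_tau_weyl.
  have -> : T (tau (l + trans v)) / T (tau l) = (T (tau l))^-1 * T (tau (l +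
    trans v)).
    by apply: commrV; apply: hecke_tau_comm.
  by rewrite lE mulrA mulrK // hecke_unit.
rewrite !(mulnC 2) !exprM.
by apply: square_ratio; apply: U.
Qed.

Lemma XA_Omega v g : stabAf g -> XA d T (alc v) * T g = XA d T (alc (v * g)%g).
Proof.
move=> gA; have [l [l0 lv lvg _]] := @deep_coweight2 R P (trans v) (trans (v *
  g)%g) 0.
rewrite (XA_alc l0 lv) (XA_alc l0 lvg) -scalerAl -mulrA hecke_mulOmega //.
by rewrite [(tau l * (v * g))%g]mulgA (weight_mulOmega _ _ gA).
Qed.

Lemma XA_prec v s : prec (alc v) s ->
  XA d T (alc v) * T (val s) = qs d s *: XA d T (alc (v * val s)%g).
Proof.
move=> /prec_alc; set c := aff_act _ _ => cp.
(* Translating by l turns the constant [c.2] into [c.2] plus the pairing of the positive root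
   [- c.1] with l. The bound [1 - c.2] makes this at least 1, the threshold for positivity over a
   negative root. The same l serves both alcoves. *)
have [l [l0 lv lvs lN]] := @deep_coweight2 R P (trans v) (trans (v * val s)%g)
  (1 - c.2).
have rc : c.1 \in roots P by rewrite aff_act_root simple_root_root.
have up : ascent (tau l * v)%g s.
  rewrite /ascent invgM aff_actM -/c.
  have -> : (tau l)^-1%g = tau (- l) :> extW P.
    by apply: mulg1_eq; rewrite tau_mul subrr.
  rewrite aff_act_tau; case: c rc cp lN => a m /= ra ap lN.
  have := lN (- a); rewrite /aff_pos /= ap pairingNr pairingNl pos_opp // ap.
  by move=> /(_ isT); lia.
rewrite (XA_alc l0 lv) (XA_alc l0 lvs) -scalerAl -mulrA hecke_ascent //.
rewrite scalerA -mulgA; congr (_ *: _).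
rewrite mulgA (weight_ascent hd) // mulnDr exprD /qs -exprM.
by rewrite invrM ?unitrX ?qhalf_unit // mulrCA mulVKr // unitrX ?qhalf_unit.
Qed.

Lemma XA_nprec v s : ~ prec (alc v) s ->
  XA d T (alc v) * T (val s) =
  XA d T (alc (v * val s)%g) + (qs d s - 1) *: XA d T (alc v).
Proof.
move=> nvs; have /XA_prec : prec (alc (v * val s)%g) s.
  apply/prec_alc; rewrite invgM SaV aff_actM simple_root_act aff_actN.
  rewrite pos_opp ?aff_act_root ?simple_root_root // negbK.
  by apply: contraT => vs; case: nvs; apply/prec_alc.
rewrite -mulgA Sa_invol mulg1 => XE.
have Uq := qs_unit s; set q := qs d s in XE Uq *.
have {1}-> : XA d T (alc v) = q^-1 *: (XA d T (alc (v * val s)%g) * T (val s)).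
  by rewrite XE scalerA mulVr // scale1r.
rewrite -scalerAl -mulrA hecke_quadE // mulrDr -!scalerAr mulr1 XE -/q.
move: (XA d T (alc v)) (XA d T _) => X Y.
by rewrite scalerDr !scalerA mulVr // scale1r mulrAC mulVr // mul1r.
Qed.

End Hecke.

(** * Galleries *)

Section Galleries.
Variables (R : realType) (P : based_root_datum R).
Implicit Types (u v : extW P) (s : Sa P) (t : gtype P) (A B C : galc P).
Implicit Types (g : seq (galc P)) (ws : seq (Sa P)).

Definition letter (x : Sa P + Omega P) : extW P :=
  match x with inl s => val s | inr w => val w end.

Definition tprod t : extW P := (\prod_(x <- t) letter x)%g.

Definition is_simple (x : Sa P + Omega P) : bool := if x is inl _ then true else
  false.

Definition next (x : Sa P + Omega P) A C : Prop :=
  match x with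
  | inl s => C = A \/ C = ract A (val s)
  | inr w => C = ract A (val w)
  end.

Lemma gallery_nilP A B g : gallery [::] A B g <-> [/\ g = [:: A], A = B &
  galcoves P A].
Proof.
split=> [[sg Gg g0 gB _]|[-> <- GA]]; last first.
  by split => // C; rewrite inE => /eqP ->.
case: g sg Gg g0 gB => [//|C [|//]] _ Gg /= <- <-; split => //.
by apply: Gg; rewrite mem_head.
Qed.

Lemma gallery_consP x t A B g : gallery (x :: t) A B g <->
  exists C g', [/\ g = A :: g', galcoves P A, next x A C & gallery t C B g'].
Proof.
split=> [[sg Gg g0 gB st]|[C [g' [-> GA xAC [sg Gg g0 gB st]]]]].
  case: g sg Gg g0 gB st => [//|A' g'] sg Gg /= A'E gB st.
  rewrite /gnth /= in A'E; rewrite {}A'E in Gg st gB *.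
  exists (gnth g' 0), g'; split => //; first by apply: Gg; rewrite mem_head.
    by have := st 0%N isT; rewrite /gstep /=; case: x {gB st sg}.
  split => //; first by case: sg.
    by move=> C Cg; apply: Gg; rewrite inE Cg orbT.
  by move=> i it; apply: (st i.+1).
split => //; first by rewrite /= sg.
  by move=> D; rewrite inE => /orP[/eqP -> //|/Gg].
case=> [_|i it]; last exact: st.
by case: x xAC => [s|w]; rewrite -g0; exact.
Qed.

Lemma gallery_subword t u B g : gallery t (alc u) B g -> exists t',
  [/\ B = alc (u * tprod t')%g & t' = t \/ (size t' < size t)%N].
Proof.
elim: t u g => [|x t IH] u g.
  move=> /gallery_nilP[_ <- _]; exists [::]; split; last by left.
  by rewrite /tprod big_nil mulg1.
move=> /gallery_consP[C [g' [_ _ xC Gg']]].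
have step : C = ract (alc u) (letter x) -> exists t',
    [/\ B = alc (u * tprod t')%g & t' = x :: t \/ (size t' < size (x :: t))%N].
  rewrite ract_alc => CE; rewrite CE in Gg'; have [t' [-> t't]] := IH _ _ Gg'.
  exists (x :: t'); split; first by rewrite /tprod big_cons mulgA.
  by case: t't => [->|lt_t]; [left|right].
case: x xC step => [s [CE _|CE]|w CE]; [|exact|exact].
rewrite CE in Gg'; have [t' [-> t't]] := IH _ _ Gg'.
by exists t'; split => //; right => /=; case: t't => [->|/ltnW].
Qed.

Lemma gallery_word u t : exists g, gallery t (alc u) (alc (u * tprod t)%g) g.
Proof.
elim: t u => [|x t IH] u.
  exists [:: alc u]; apply/gallery_nilP; split => //; last exact: alc_galcoves.
  by rewrite /tprod big_nil mulg1.
have [g Gg] := IH (u * letter x)%g; exists (alc u :: g); apply/gallery_consP.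
exists (alc (u * letter x)%g), g; split => //; first exact: alc_galcoves.
  by case: x {g Gg} => [s|w] /=; rewrite ract_alc //; right.
by rewrite /tprod big_cons mulgA.
Qed.

Lemma tprod_rcons t x : tprod (rcons t x) = (tprod t * letter x)%g.
Proof. by rewrite /tprod -cats1 big_cat big_seq1. Qed.

Lemma ell_tprod t : (ell (tprod t) <= count is_simple t)%N.
Proof.
elim/last_ind: t => [|t x IH]; first by rewrite /tprod big_nil ell1.
rewrite tprod_rcons -cats1 count_cat /= addn0.
case: x => [s|[w wA]] /=; last by rewrite addn0 ell_mulOmega.
by rewrite addn1; apply: leq_trans (ell_mul_leq _ _) _.
Qed.

Lemma tprod_map_inl ws : tprod (map inl ws) = wprod ws.
Proof. by rewrite /tprod big_map. Qed.

Lemma all_simpleP t : all is_simple t -> exists ws, t = map inl ws.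
Proof.
elim: t => [|[s|//] t IH]; first by exists [::].
by move=> /IH[ws ->]; exists (s :: ws).
Qed.

(** A fold skips a letter, so a minimal gallery has none and its type multiplies to v. Minimality
    counts the letters of Omega as well, so reducedness of the simple letters needs an argument. *)
Lemma minimal_galleryP t v g : minimal_gallery t (alc 1%g) (alc v) g ->
  v = tprod t /\ ell v = count is_simple t.
Proof.
move=> [Gg gmin].
have tmin t' : tprod t' = v -> (size t <= size t')%N.
  move=> t'v; have [g' Gg'] := gallery_word 1%g t'.
  rewrite mul1g t'v in Gg'; have := gmin _ _ Gg'.
  by case: Gg => -> _ _ _ _; case: Gg' => -> _ _ _ _.
have [t' [/alc_inj]] := gallery_subword Gg; rewrite mul1g => vE.
case=> [t'E|lt_t]; last by have := tmin t' (esym vE); rewrite leqNgt lt_t.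
rewrite {}t'E {t'} in vE; split => //; apply/eqP;
  rewrite eqn_leq {1}vE ell_tprod /=.
rewrite leqNgt; apply/negP => lt_ell.
have [ws [w vw] sws] := word_exists v.
(* A reduced word followed by a single letter of Omega is a competing type. *)
have size_t : (size t <= (ell v).+1)%N.
  rewrite -sws -(size_map inl ws : size (map (@inl _ (Omega P)) ws) = _) -addn1.
  rewrite -[1%N]/(size [:: inr w : Sa P + Omega P]) -size_cat; apply: tmin.
  by rewrite vw /tprod big_cat big_seq1 -/(tprod _) tprod_map_inl.
(* If the simple letters exceed the length of v, they already fill the bound [size_t]: no letter of
   Omega is left, and deletion gives a shorter type. *)
have /all_simpleP[ws' tE] : all is_simple t.
  by rewrite all_count eqn_leq count_size (leq_trans size_t lt_ell).
have [|ws2 lt_ws2 ws2E] := @deletion _ _ ws'.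
  rewrite -tprod_map_inl -tE -vE; apply: leq_trans lt_ell _.
  by rewrite tE count_map; apply: count_size.
have := tmin (map inl ws2); rewrite tprod_map_inl ws2E -tprod_map_inl -tE.
by move=> /(_ (esym vE)); rewrite tE !size_map leqNgt lt_ws2.
Qed.

Lemma pos_folded_cons x t A g : pos_folded (x :: t) (A :: g) <->
  (forall s, x = inl s -> gnth g 0 = A -> ~ prec A s) /\ pos_folded t g.
Proof.
split=> [pf|[pf0 pf] s [|i]].
- split=> [s xs gA|s i fi]; last exact: (pf s i.+1).
  by apply: (pf s 0%N); split => //; rewrite xs.
- by move=> [[xs] gA]; apply: pf0.
- exact: pf.
Qed.

(** Lists the positively folded galleries from A_u with free endpoint; splitting off the first step
    matches multiplication of X_A by one factor. *)
Fixpoint pgal t u : seq (seq (galc P)) :=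
  match t with
  | [::] => [:: [:: alc u]]
  | inl s :: t => map (cons (alc u)) (pgal t (u * val s)%g) ++
      (if `[< prec (alc u) s >] then [::] else map (cons (alc u)) (pgal t u))
  | inr w :: t => map (cons (alc u)) (pgal t (u * val w)%g)
  end.

(** Ensures that no step is both a fold and a crossing, so the two branches of [pgal] are disjoint
    and weights are unambiguous. *)
Lemma alc_simple_neq u s : alc (u * val s)%g <> alc u.
Proof.
move=> /alc_inj us; have := ascent_mul u s; rewrite us.
by case: (ascent u s).
Qed.

Lemma mem_pgal t u g : g \in pgal t u <->
  gallery t (alc u) (gnth g (size t)) g /\ pos_folded t g.
Proof.
elim: t u g => [|x t IH] u g.
  rewrite inE; split=> [/eqP ->|[/gallery_nilP[-> _ _] _] //].
  split; last by move=> s [|i] [].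
  by apply/gallery_nilP; split => //; exact: alc_galcoves.
split.
  case: x => [s|w] /=; rewrite ?mem_cat; last first.
    case/mapP=> g' /IH[Gg pf] ->; split; last by apply/pos_folded_cons.
    apply/gallery_consP; exists (alc (u * val w)%g), g'; split => //=.
      exact: alc_galcoves.
    by rewrite ract_alc.
  case/orP=> [/mapP[g' /IH[Gg pf] ->]|].
    split.
      apply/gallery_consP; exists (alc (u * val s)%g), g'; split => //=.
        exact: alc_galcoves.
      by right; rewrite ract_alc.
    apply/pos_folded_cons; split => // s' _; case: Gg => _ _ -> _ _.
    by move=> /alc_simple_neq.
  case: asboolP => // ns /mapP[g' /IH[Gg pf] ->]; split.
    apply/gallery_consP; exists (alc u), g'; split => //=; last by left.
    exact: alc_galcoves.
  by apply/pos_folded_cons; split => // s' [<-].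
move=> [/gallery_consP[C [g' [-> _ xC Gg]]] /pos_folded_cons[pf0 pf]].
have {}Gg : gallery t C (gnth g' (size t)) g' := Gg.
have g'0 : gnth g' 0 = C by case: Gg.
case: x xC pf0 => [s|w] /= xC pf0; last first.
  by rewrite map_f //; apply/IH; rewrite -ract_alc -xC.
rewrite mem_cat; case: xC => CE; apply/orP; [right|left].
  case: asboolP => [ps|ns]; first by case: (pf0 s erefl (etrans g'0 CE)).
  by rewrite map_f //; apply/IH; rewrite -CE.
by rewrite map_f //; apply/IH; rewrite -ract_alc -CE.
Qed.

Lemma pgal_uniq t u : uniq (pgal t u).
Proof.
have cI A : injective (cons A : seq (galc P) -> _) by move=> g g' [].
elim: t u => [//|[s|w] t IH] u /=; last by rewrite (map_inj_uniq (@cI _)).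
case: asboolP => _; first by rewrite cats0 (map_inj_uniq (@cI _)).
rewrite cat_uniq !(map_inj_uniq (@cI _)) !IH andbT /=.
apply/hasPn => _ /mapP[g + ->]; apply: contraL; rewrite (mem_map (@cI _)).
move=> /mem_pgal[[_ _ + _ _] _] => g0; apply/negP => /mem_pgal[[_ _ + _ _] _].
by rewrite g0 => /alc_simple_neq.
Qed.

End Galleries.

(** * Weights of galleries and their finite sums *)

Section GallerySums.
Variables (R : realType) (P : based_root_datum R) (d : Sa P -> nat).
Implicit Types (u v : extW P) (s : Sa P) (t : gtype P) (A B C : galc P).
Implicit Types (g : seq (galc P)).

Lemma num_pos_dir_cons x t A g s : num_pos_dir (x :: t) (A :: g) s =
  (`[< pos_direction (x :: t) (A :: g) s 0 >] + num_pos_dir t g s)%N.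
Proof. by rewrite /num_pos_dir /= -[1%N]addn0 iotaDl count_map. Qed.

Lemma num_fold_cons x t A g s : num_fold (x :: t) (A :: g) s =
  (`[< fold (x :: t) (A :: g) s 0 >] + num_fold t g s)%N.
Proof. by rewrite /num_fold /= -[1%N]addn0 iotaDl count_map. Qed.

(** Freedom in [S] lets the weights of a gallery and of its tail be compared over one index list. *)
Lemma Lg_finite t g (S : seq (Sa P)) : uniq S ->
  (forall s, inl s \in t -> s \in S) ->
  Lg d t g = \prod_(s <- S) (qs d s ^+ num_pos_dir t g s *
                             (qs d s - 1) ^+ num_fold t g s).
Proof.
move=> uS tS; rewrite /Lg (fsbigE S) //.
  by under eq_bigl => s do rewrite in_setT.
move=> s _ sS; have no (i : nat) : onth t i <> Some (inl s).
  move=> ti; move/negP: sS; apply; apply: tS.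
  have <- : nth (inl s) t i = inl s by exact: onth_nth.
  by rewrite mem_nth // -onthTE ti.
rewrite /num_pos_dir /num_fold !(@eq_count _ _ pred0) ?count_pred0 ?mulr1 //.
  by move=> i; apply/asboolP => -[/no].
by move=> i; apply/asboolP => -[/no].
Qed.

Lemma Lg_nil g : Lg d [::] g = 1.
Proof. by rewrite (@Lg_finite _ _ [::]) // big_nil. Qed.

Lemma Lg_Omega (w : Omega P) t A g : Lg d (inr w :: t) (A :: g) = Lg d t g.
Proof.
pose S := undup (pmap (fun x => if x is inl s then Some s else None) t).
have tS s : inl s \in t -> s \in S.
  by move=> st; rewrite mem_undup mem_pmap; apply/mapP; exists (inl s).
rewrite !(@Lg_finite _ _ S) ?undup_uniq //; apply: eq_bigr => s _.
by rewrite num_pos_dir_cons num_fold_cons !asboolF // => -[].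
Qed.

Lemma Lg_simple s t A g : Lg d (inl s :: t) (A :: g) =
  qs d s ^+ `[< gnth g 0 = ract A (val s) /\ prec A s >] *
  (qs d s - 1) ^+ `[< gnth g 0 = A >] * Lg d t g.
Proof.
pose S := undup (s :: pmap (fun x => if x is inl s then Some s else None) t).
have sS : s \in S by rewrite mem_undup mem_head.
have tS s' : inl s' \in t -> s' \in S.
  move=> st; rewrite mem_undup inE mem_pmap; apply/orP; right.
  by apply/mapP; exists (inl s').
have uS : uniq S by exact: undup_uniq.
rewrite !(@Lg_finite _ _ S) //; last first.
  by move=> s'; rewrite inE => /orP[/eqP[->]|/tS].
rewrite [in LHS](bigD1_seq s) //= [in RHS](bigD1_seq s) //= mulrA;
  congr (_ * _).
  rewrite num_pos_dir_cons num_fold_cons !exprD mulrACA;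
    congr (_ ^+ _ * _ ^+ _ * _).
    by congr nat_of_bool; apply/asboolP/asboolP => -[].
  by congr nat_of_bool; apply/asboolP/asboolP => [[]|].
apply: eq_bigr => s' ss'; rewrite num_pos_dir_cons num_fold_cons !asboolF //.
  by move=> -[[ss]]; rewrite ss eqxx in ss'.
by move=> -[[ss]]; rewrite ss eqxx in ss'.
Qed.

Lemma Lt_pgal t u B :
  Lt d t (alc u) B = \sum_(g <- pgal t u | gnth g (size t) == B) Lg d t g.
Proof.
rewrite -big_filter fsbig_seq ?filter_uniq ?pgal_uniq // /Lt;
  congr (\sum_(g \in _) _).
apply/seteqP; split => g /=; rewrite mem_filter.
  move=> [Gg pf]; have gB : gnth g (size t) = B by case: Gg.
  by rewrite gB eqxx; apply/mem_pgal; rewrite gB.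
by move=> /andP[/eqP <-] /mem_pgal.
Qed.

Variables (H : unitAlgType laurent) (X : galc P -> H).

(** Groups the galleries by endpoint; an unreached B contributes an empty sum, so the support is
    finite. *)
Lemma sum_Lt_pgal t u :
  \sum_(B \in galcoves P) Lt d t (alc u) B *: X B =
  \sum_(g <- pgal t u) Lg d t g *: X (gnth g (size t)).
Proof.
pose fin g := gnth g (size t).
pose r := undup (map fin (pgal t u)).
have rG B : B \in r -> galcoves P B.
  rewrite mem_undup => /mapP[g /mem_pgal[[sg Gg _ _ _] _] ->].
  by apply: Gg; rewrite mem_nth // sg.
rewrite (fsbigE r) ?undup_uniq //; last first.
  move=> B _ Br; rewrite Lt_pgal big_seq_cond big1 ?scale0r // =>
    g /andP[gG /eqP gB].
  by move: Br; rewrite mem_undup -gB -/(fin g) map_f.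
rewrite big_seq_cond; under eq_bigl => B.
  by rewrite (_ : _ && _ = (B \in r)); [over|apply/andb_idr => /rG;
    rewrite in_setE].
rewrite -big_seq; under eq_bigr =>
  B _ do rewrite Lt_pgal scaler_suml big_mkcond.
rewrite exchange_big; apply: eq_big_seq => g gG /=; rewrite -big_mkcond /=.
have gr : fin g \in r by rewrite mem_undup map_f.
rewrite (big_rem _ gr) /= eqxx big_seq_cond big_pred0 ?addr0 // => B.
apply/negbTE/negP; rewrite (rem_filter _ (undup_uniq _)) mem_filter /=.
by move=> /andP[/andP[/negbTE BN _]]; rewrite eq_sym BN.
Qed.

End GallerySums.

(** * Expansion of X_A T_v over galleries *)

Section Expansion.
Variables (R : realType) (P : based_root_datum R) (d : Sa P -> nat).
Hypothesis hd : conj_invariant d.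
Variables (H : unitAlgType laurent) (T : extW P -> H).
Hypothesis hT : hecke_algebra d T.
Implicit Types (u v : extW P) (t : gtype P).

(** A prefix is never longer than its number of simple letters, so equality for t forces every
    simple letter to be an ascent. *)
Lemma hecke_tprod t : ell (tprod t) = count (@is_simple R P) t ->
  T (tprod t) = \prod_(x <- t) T (letter x).
Proof.
elim/last_ind: t => [|t x IH]; first by rewrite /tprod !big_nil (hecke1 hT).
rewrite tprod_rcons -cats1 count_cat big_cat big_seq1 /= addn0.
case: x => [s|[w wA]] /=.
  rewrite addn1 => ell_ts; have us : ascent (tprod t) s.
    apply: contraT => /ell_descent; rewrite ell_ts => ell_t.
    by have := ell_tprod t; rewrite ell_t ltnNge leqnSn.
  rewrite -(hecke_ascent hT us) IH //.
  by move: ell_ts; rewrite ell_ascent // => -[].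
by rewrite addn0 ell_mulOmega // => /IH <-; rewrite (hecke_mulOmega hT).
Qed.

Lemma XA_expansion t u :
  XA d T (alc u) * \prod_(x <- t) T (letter x) =
  \sum_(g <- pgal t u) Lg d t g *: XA d T (gnth g (size t)).
Proof.
have head g t' u' : g \in pgal t' u' -> gnth g 0 = alc u'.
  by move=> /mem_pgal[[]].
elim: t u => [|x t IH] u;
  first by rewrite big_nil mulr1 big_seq1 Lg_nil scale1r.
rewrite big_cons mulrA; case: x => [s|[w wA]] /=; last first.
  rewrite big_map (XA_Omega hd hT) // IH.
  by apply: eq_bigr => g _; rewrite Lg_Omega.
have us := @alc_simple_neq _ _ u s.
(* A crossing costs q_s in the positive direction and 1 otherwise; both cases are covered by a
   boolean exponent. *)
have cross : \sum_(g <- map (cons (alc u)) (pgal t (u * val s)%g))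
      Lg d (inl s :: t) g *: XA d T (gnth g (size t).+1) =
    qs d s ^+ `[< prec (alc u) s >] *:
      \sum_(g <- pgal t (u * val s)%g) Lg d t g *: XA d T (gnth g (size t)).
  rewrite big_map scaler_sumr; apply: eq_big_seq => g /head g0.
  rewrite scalerA Lg_simple g0 ract_alc; congr (_ *: _); congr (_ * _).
  rewrite [X in _ ^+ nat_of_bool X * _ = _](_ : _ = `[< prec (alc u) s >]).
    by rewrite (asboolF us) mulr1.
  by apply/asboolP/asboolP => [[]|].
rewrite big_cat cross -IH /=; case: asboolP => [p|np] /=.
  by rewrite big_nil addr0 expr1 (XA_prec hd hT) // -scalerAl.
rewrite expr0 scale1r (XA_nprec hd hT) // mulrDl -(scalerAl _ (XA d T (alc u)))
  [X in _ + _ *: X]IH.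
congr (_ + _); rewrite big_map scaler_sumr; apply: eq_big_seq => g /head g0.
rewrite scalerA Lg_simple g0 ract_alc asboolF; last by move=> [/esym/us].
by rewrite asboolT // expr0 expr1 mul1r.
Qed.

End Expansion.

Theorem theorem5p5 (R : realType) (P : based_root_datum R)
  (d : Sa P -> nat) (hd : conj_invariant d)
  (H : unitAlgType laurent) (T : extW P -> H) (hT : hecke_algebra d T)
  (v : extW P) (t : gtype P)
  (ht : exists g, minimal_gallery t (alc (1%g : extW P)) (alc v) g)
  (A : galc P) (hA : galcoves P A) :
  XA d T A * T v = \sum_(B \in galcoves P) Lt d t A B *: XA d T B.
Proof.
have [u ->] := galcoves_alc hA; have [g /minimal_galleryP[-> ell_t]] := ht.
by rewrite (hecke_tprod hT) // (XA_expansion hd hT) -sum_Lt_pgal.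
Qed.
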